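(* Let $0<\alpha<1$, let $I\subset\mathbb{R}$ be an interval, $t_0\in I$, let $A$ be an $n\times n$ matrix function continuous on $I$, let $u:I\to\mathbb{R}^n$ be continuous on $I$, and let $x_0\in\mathbb{R}^n$. Assume that the generalized Peano--Baker series $\Phi(t,s)=\sum_{k=0}^{\infty}{}_{s}J_t^{k\circ\alpha}A(t)$ converges uniformly in $t\in I$, $t>s$, for each initial point $s\in I$. Then a solution to the initial value problem $${}_{t_0}D_t^{\alpha}x(t)=A(t)x(t)+u(t),\quad t\in I,\ t>t_0,\qquad {}_{t_0}J_t^{1-\alpha}x(t)\big|_{t=t_0}=x_0,$$ is given by $$x(t)=\Phi(t,t_0)x_0+\int_{t_0}^t\Phi(t,\tau)u(\tau)\,d\tau .$$
   Context: The Riemann--Liouville fractional integral of order $\beta>0$ and derivative of order $\alpha\in(0,1)$, with lower limit $s\in I$ and $t\in I$, $t>s$, are $${}_{s}J_t^{\beta}f(t)=\frac{1}{\Gamma(\beta)}\int_{s}^t(t-\tau)^{\beta-1}f(\tau)\,d\tau,\qquad {}_{s}D_t^{\alpha}f(t)=\frac{d}{dt}\,{}_{s}J_t^{1-\alpha}f(t),$$ applied entrywise to vector and matrix functions. The value at $t=t_0$ of ${}_{t_0}J_t^{1-\alpha}x(t)$ is understood as the limit $t\to t_0+$. State-transition matrix: for $s,t\in I$, $s<t$, $\Phi(t,s)=\sum_{k=0}^{\infty}{}_{s}J_t^{k\circ\alpha}A(t)$, where, with $\mathrm{Id}$ the $n\times n$ identity matrix, $${}_{s}J_t^{0\circ\alpha}A(t)=\frac{(t-s)^{\alpha-1}}{\Gamma(\alpha)}\mathrm{Id},\qquad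 {}_{s}J_t^{(k+1)\circ\alpha}A(t)={}_{s}J_t^{\alpha}\bigl(A(t)\,{}_{s}J_t^{k\circ\alpha}A(t)\bigr),\quad k=0,1,\ldots$$ *)

(* Defs.v *)
From HB Require Import structures.
From mathcomp Require Import all_boot all_order all_algebra.
From mathcomp Require Import all_classical all_reals all_analysis.
Set Implicit Arguments.
Unset Strict Implicit.
Unset Printing Implicit Defensive.
Import Order.TTheory GRing.Theory Num.Theory.
Import numFieldNormedType.Exports.
Local Open Scope classical_set_scope.
Local Open Scope ring_scope.

Definition Gamma {R : realType} (z : R) : R :=
  \int[@lebesgue_measure R]_(t in `]0, +oo[) (t `^ (z - 1) * expR (- t)).

Definition mx_integral {R : realType} {m p : nat} (s t : R)
    (f : R -> 'M[R]_(m, p)) : 'M[R]_(m, p) :=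
  \matrix_(i, j) \int[@lebesgue_measure R]_(tau in `]s, t[) f tau i j.

(* [mx_integral] is only meaningful under this condition: the library integral
   is a total function. *)
Definition mx_integrable {R : realType} {m p : nat} (s t : R)
    (f : R -> 'M[R]_(m, p)) : Prop :=
  forall i j, (@lebesgue_measure R).-integrable `]s, t[
    (fun tau => (f tau i j)%:E).

Definition RL_kernel {R : realType} {m p : nat} (beta : R)
    (f : R -> 'M[R]_(m, p)) (t tau : R) : 'M[R]_(m, p) :=
  (t - tau) `^ (beta - 1) *: f tau.

Definition RL_int {R : realType} {m p : nat} (beta s : R)
    (f : R -> 'M[R]_(m, p)) (t : R) : 'M[R]_(m, p) :=
  (Gamma beta)^-1 *: mx_integral s t (RL_kernel beta f t).

(* The difference quotient is restricted to [I]: this is the usual derivative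
   at interior points and the one-sided one at an endpoint belonging to [I]. *)
Definition is_derivative_in {R : realType} {m p : nat} (I : interval R)
    (F : R -> 'M[R]_(m, p)) (t : R) (l : 'M[R]_(m, p)) : Prop :=
  (r - t)^-1 *: (F r - F t) @[r --> within [set` I] t^'] --> l.

Definition is_RL_derivative {R : realType} {m p : nat} (I : interval R)
    (alpha s : R) (f : R -> 'M[R]_(m, p)) (t : R) (l : 'M[R]_(m, p)) : Prop :=
  is_derivative_in I (RL_int (1 - alpha) s f) t l.

Fixpoint PB_term {R : realType} {n : nat} (alpha : R) (A : R -> 'M[R]_n)
    (s : R) (k : nat) (t : R) : 'M[R]_n :=
  match k with
  | 0%N => ((t - s) `^ (alpha - 1) / Gamma alpha)%:M
  | k'.+1 => RL_int alpha s (fun tau => A tau *m PB_term alpha A s k' tau) t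
  end.

Definition PB_partial {R : realType} {n : nat} (alpha : R) (A : R -> 'M[R]_n)
    (s : R) (N : nat) (t : R) : 'M[R]_n :=
  \sum_(0 <= k < N) PB_term alpha A s k t.

Definition PB_Phi {R : realType} {n : nat} (alpha : R) (A : R -> 'M[R]_n)
    (t s : R) : 'M[R]_n :=
  limn (fun N => PB_partial alpha A s N t).

Definition PB_converges_uniformly {R : realType} {n : nat} (I : interval R)
    (alpha : R) (A : R -> 'M[R]_n) : Prop :=
  forall s, s \in I ->
    {uniform [set t | t \in I /\ s < t],
      PB_partial alpha A s @ \oo --> (fun t => PB_Phi alpha A t s)}.

(* The values of [x] only matter on the part of [I] to the right of [t0]. The
   initial condition is a right limit taken inside [I], hence vacuous when [t0]
   is the right endpoint of [I]. *)
Definition is_RL_IVP_solution {R : realType} {n : nat} (I : interval R)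
    (alpha t0 : R) (A : R -> 'M[R]_n) (u : R -> 'cV[R]_n) (x0 : 'cV[R]_n)
    (x : R -> 'cV[R]_n) : Prop :=
  [/\ forall t, t \in I -> t0 < t ->
        mx_integrable t0 t (RL_kernel (1 - alpha) x t),
      forall t, t \in I -> t0 < t ->
        is_RL_derivative I alpha t0 x t (A t *m x t + u t) &
      RL_int (1 - alpha) t0 x t @[t --> within [set` I] t0^'+] --> x0].

(* Main.v *)
Require Import Defs.
From HB Require Import structures.
From mathcomp Require Import all_boot all_order all_algebra.
From mathcomp Require Import all_classical all_reals all_analysis.
From mathcomp Require Import measurable_realfun ring lra.
Set Implicit Arguments.
Unset Strict Implicit.
Unset Printing Implicit Defensive.
Import Order.TTheory GRing.Theory Num.Theory.
Import numFieldNormedType.Exports.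
Local Open Scope classical_set_scope.
Local Open Scope ring_scope.

(** Write T_k(t, s) for the terms of the generalized Peano-Baker series,
  T_0(t, s) = (t - s)^(alpha - 1) / Gamma(alpha) Id, and J for the fractional
  integral with lower limit t0. The initial value problem is the differentiated
  form of a Volterra equation of Abel type,
    x(t) = (t - t0)^(alpha - 1) / Gamma(alpha) x0 + J^alpha (A x + u)(t).
  Indeed, applying J^(1 - alpha) and exchanging the integrals, Euler's identity
  B(1 - alpha, alpha) = Gamma(1 - alpha) Gamma(alpha) gives
    J^(1 - alpha) x (t) = x0 + int_t0^t (A x + u),
  (abel_sol_RL). The right limit of this at t0 is x0 because A x + u is
  integrable near t0 (primitive_cvg0), and its derivative at t > t0 is
  A x + u because x is continuous there (abel_int_continuous,
  primitive_derivative).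

  That the announced x solves the Volterra equation (pb_sol_volterra) follows
  from Phi = T_0 + J^alpha (A Phi) (pb_resolvent_fixpoint) by one more exchange
  of integrals. Both exchanges, and the joint measurability of Phi in its two
  arguments that they need, rest on a bound of Phi(t, s) that is uniform in s.
  It comes from the weight w(r) = r^(alpha - 1) e^(l r), r > 0: the convolution
  of r^(alpha - 1) with w is at most q(l) w, where q(l) is a multiple of
  l^(- alpha) (wpowker_conv_le). For l large the operator J^alpha (A .)
  therefore halves bounds by w, so T_k is at most 2^(-k) w / Gamma(alpha), and
  a geometric series replaces the Mittag-Leffler estimate.

  All kernels are extended by 0 to t <= s, so that every integral runs over
  the whole line and no domain has to be tracked. On [t0, T] the coefficients A
  and u are replaced by their compositions with the projection of the line onto
  [t0, T], which are bounded and continuous on the line; at times in [t0, T]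
  this changes neither Phi nor x (PB_PhiE, sol_pb_sol). *)

(** * Affine changes of variable *)
Section lebesgue_change_of_variable.
Context {R : realType}.
Notation mu := (@lebesgue_measure R).
Local Open Scope ereal_scope.

(** Lebesgue measure is the only measure with its values on half-open intervals,
  and the image measure, rescaled, has these values. In this
  generality the lemma covers singular integrands. *)
Lemma ge0_integral_affine (a b : R) (f : R -> \bar R) : (a != 0)%R ->
  measurable_fun [set: R] f -> (forall x, 0 <= f x) ->
  \int[mu]_x f x = `|a|%:E * \int[mu]_x f (a * x + b)%R.
Proof.
move=> a0 mf f0.
pose phi : R -> measurableTypeR R := fun x => (a * x + b)%R.
have mphi : measurable_fun [set: R] phi.
  by apply: measurable_funD => //; apply: measurable_funM.
have an : (0 <= `|a|)%R by [].
have [nu nuE] : exists nu : {measure set (measurableTypeR R) -> \bar R},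
    forall A, nu A = mu (phi @^-1` A).
  by unshelve eexists; [apply: (pushforward mu phi : {measure set _ -> \bar R})|].
transitivity (\int[mscale (NngNum an) nu]_x f x).
  apply: eq_measure_integral => A mA _ /=.
  apply: lebesgue_measure_unique => // X [[l r] _ <-].
  rewrite /mscale /= [X in _ = _ * X]nuE.
  have [a_gt0|a_lt0] : (0 < a)%R \/ (a < 0)%R.
    by case: (ltgtP a 0%R) a0 => //; [right|left].
  - rewrite (_ : phi @^-1` _ = `](l - b) / a, (r - b) / a]%classic)%R; last first.
      apply/seteqP; split => x; rewrite /phi /= !in_itv/= ler_pdivlMr// ltr_pdivrMr//;
      by rewrite mulrC ltrBlDr lerBrDr.
    rewrite !lebesgue_measure_itv /= !lte_fin ltr_pM2r ?invr_gt0//.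
    rewrite ltrD2r; case: ifPn => _; last by rewrite mule0.
    rewrite -!EFinD -EFinM gtr0_norm//; congr EFin.
    by field.
  - rewrite (_ : phi @^-1` _ = `[(r - b) / a, (l - b) / a[%classic)%R; last first.
      apply/seteqP; split => x; rewrite /phi /= !in_itv/= ler_ndivrMr// ltr_ndivlMr//;
      rewrite [(_ * a)%R]mulrC ltrBlDr lerBrDr andbC//.
    rewrite !lebesgue_measure_itv /= !lte_fin ltr_nM2r ?invr_lt0//.
    rewrite ltrD2r; case: ifPn => _; last by rewrite mule0.
    rewrite -!EFinD -EFinM ltr0_norm//; congr EFin.
    by field; rewrite lt_eqF.
rewrite ge0_integral_mscale//; congr (_ * _).
transitivity (\int[pushforward mu phi]_x f x).
  by apply: eq_measure_integral => A _ _; exact: nuE.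
by rewrite ge0_integral_pushforward.
Qed.

End lebesgue_change_of_variable.

(** * Power kernels and the Gamma function *)
Section power_kernel.
Context {R : realType}.
Notation mu := (@lebesgue_measure R).
Implicit Types (a r l : R).

(** The kernel of the fractional integral up to 1 / Gamma(a), extended by 0 to
  r <= 0; [powR] itself is 1 at negative arguments when the exponent is not 0. *)
Definition powker a r : R := if 0 < r then r `^ (a - 1) else 0.

Lemma powker_ge0 a r : 0 <= powker a r.
Proof. by rewrite /powker; case: ifP => // _; exact: powR_ge0. Qed.

Lemma powker_npos a r : r <= 0 -> powker a r = 0.
Proof. by rewrite /powker leNgt; case: ifP. Qed.

Lemma powker_pos a r : 0 < r -> powker a r = r `^ (a - 1).
Proof. by rewrite /powker => ->. Qed.

Lemma measurable_powker a : measurable_fun [set: R] (powker a).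
Proof.
by apply: measurable_fun_ifT => //; exact: measurable_fun_ltr.
Qed.

Lemma powker_scale a c r : 0 < c -> powker a (c * r) = c `^ (a - 1) * powker a r.
Proof.
move=> c0; rewrite /powker pmulr_rgt0//; case: ifPn => r0; last by rewrite mulr0.
by rewrite powRM// ltW.
Qed.

(** On the intervals [1 / (n + 1), 1] the antiderivative r^a / a bounds the
  integrals by 1 / a, and monotone convergence removes the singular end. *)
Lemma integral_powker01_lty a : 0 < a ->
  (\int[mu]_(r in `]0%R, 1%R]) (powker a r)%:E < +oo)%E.
Proof.
move=> a0.
pose F (n : nat) : set R := `[n.+1%:R^-1, 1]%classic.
have F0 n x : F n x -> 0 < x.
  by rewrite /F/= in_itv/= => /andP[+ _]; apply: lt_le_trans; rewrite invr_gt0.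
have -> : `]0%R, 1%R]%classic = \bigcup_n F n.
  apply/seteqP; split => [x/= /[!in_itv]/= /andP[x0 x1]|x [n _ Fx]].
    exists (Num.truncn x^-1) => //; rewrite /F/= in_itv/= x1 andbT.
    by rewrite -[leRHS]invrK lef_pV2 ?posrE ?invr_gt0// ltW// truncnS_gt.
  by have x0 := F0 _ _ Fx; move: Fx; rewrite /F/= !in_itv/= x0 => /andP[].
have Fpk n : (\int[mu]_(r in F n) (powker a r)%:E <= (a^-1)%:E)%E.
  case: n => [|n].
    by rewrite /F invr1 set_itv1 integral_set1 lee_fin invr_ge0 ltW.
  have n1 : n.+2%:R^-1 < 1 :> R by rewrite invf_lt1// ltr1n.
  have F0' (x : R) : n.+2%:R^-1 <= x -> 0 < x by apply: lt_le_trans; rewrite invr_gt0.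
  under eq_integral => x /set_mem/F0 x0 do rewrite powker_pos//.
  have dpow (x : R) : 0 < x -> is_derive x 1 (fun x => a^-1 * x `^ a) (x `^ (a - 1)).
    move=> x0; have da := is_derive1_powR a x0.
    apply: (is_derive_eq (@is_deriveZ _ _ _ _ a^-1 _ _ _ da)).
    by rewrite /GRing.scale/= mulrA mulVf ?gt_eqF// mul1r.
  have cpow b x : 0 < x -> {for x, continuous (fun x : R => x `^ b)}.
    move=> x0; apply/differentiable_continuous/derivable1_diffP.
    by apply: derivable_powR; rewrite in_itv/= x0.
  rewrite (@continuous_FTC2 _ _ (fun x => a^-1 * x `^ a))//.
  - rewrite powR1 mulr1 -EFinB lee_fin lerBlDr lerDl.
    by rewrite mulr_ge0 ?powR_ge0// invr_ge0 ltW.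
  - apply: continuous_in_subspaceT => x /set_mem /= /[!in_itv]/= /andP[/F0' x0 _].
    exact: cpow.
  - split.
    + move=> x /[!in_itv]/= /andP[/ltW/F0' x0 _].
      by have [] := dpow _ x0.
    + apply: cvg_at_right_filter; apply: cvgMr; exact/cpow/F0'.
    + apply: cvg_at_left_filter; apply: cvgMr; exact/cpow.
  - move=> x /[!in_itv]/= /andP[/ltW/F0' x0 _].
    by rewrite derive1E; have [_] := dpow _ x0.
apply: (@le_lt_trans _ _ (a^-1)%:E); last exact: ltry.
have ndF : nondecreasing_seq F.
  move=> m n mn; apply/subsetPset => x; rewrite /F/= !in_itv/= => /andP[+ ->].
  rewrite andbT; apply: le_trans; rewrite lef_pV2 ?posrE// ler_nat ltnS//.
have mpk (D : set R) : measurable_fun D (fun r => (powker a r)%:E).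
  by apply/measurable_EFinP; apply: measurable_funTS; exact: measurable_powker.
have := @ge0_nondecreasing_set_cvg_integral _ (measurableTypeR R) R F (fun r => (powker
    a r)%:E) mu ndF
  (fun=> measurable_itv _) (fun i => mpk (F i)) (fun _ _ _ => ltac:(by rewrite lee_fin
      powker_ge0)).
move=> /cvg_lim <-//; apply: lime_le; last by apply: nearW.
apply: ereal_nondecreasing_is_cvgn.
apply: (@ge0_nondecreasing_set_nondecreasing_integral _ (measurableTypeR R) R F
  (fun r => (powker a r)%:E) mu ndF).
- by move=> i; exact: measurable_itv.
- by move=> i; exact: mpk.
- by move=> i x _; rewrite lee_fin powker_ge0.
Qed.

Lemma measurable_powker_exp a l :
  measurable_fun [set: R] (fun r => powker a r * expR (- (l * r))).
Proof.
apply: measurable_funM; first exact: measurable_powker.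
by apply: measurableT_comp => //; apply: measurableT_comp => //.
Qed.

Lemma gamma_integral_lty a : 0 < a <= 1 ->
  (\int[mu]_r (powker a r * expR (- r))%:E < +oo)%E.
Proof.
move=> /andP[a0 a1].
have mf : measurable_fun [set: R] (fun r => (powker a r * expR (- r))%:E).
  apply/measurable_EFinP; have := @measurable_powker_exp a 1.
  by under eq_fun do rewrite mul1r.
pose f r : R := if r <= 1 then powker a r else 0.
have f0 x : 0 <= f x by rewrite /f; case: ifP => // _; exact: powker_ge0.
have mpf : measurable_fun [set: R] (fun x => (f x)%:E).
  apply/measurable_EFinP; apply: measurable_fun_ifT => //.
    exact: measurable_fun_ler.
  exact: measurable_powker.
pose g r : R := exponential_pdf 1 r.
have mg : measurable_fun [set: R] (fun x => (g x)%:E).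
  by apply/measurable_EFinP; exact: measurable_exponential_pdf.
apply: (@le_lt_trans _ _ (\int[mu]_r ((f r)%:E + (g r)%:E))%E).
  apply: ge0_le_integral => //.
  - by move=> x _; rewrite lee_fin mulr_ge0// ?powker_ge0 ?expR_ge0.
  - exact: emeasurable_funD.
  - move=> x _; rewrite -EFinD lee_fin.
    have [x0|x0] := leP x 0.
      by rewrite powker_npos// mul0r addr_ge0// exponential_pdf_ge0.
    rewrite /g exponential_pdfE; last exact: ltW.
    rewrite /= mul1r mulN1r /f; case: (leP x 1) => x1.
      rewrite -[leLHS]addr0 lerD ?expR_ge0//.
      by rewrite ler_piMr ?powker_ge0// -expR0 ler_expR oppr_le0 ltW.
    rewrite add0r ler_piMl ?expR_ge0// powker_pos//.
    by rewrite -[leRHS](powRr0 x) ler_powR ?subr_le0// ltW.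
rewrite ge0_integralD//; last 2 first.
- by move=> x _; rewrite lee_fin.
- by move=> x _; rewrite lee_fin exponential_pdf_ge0.
rewrite integral_exponential_pdf// lte_add_pinfty ?ltry//.
rewrite [ltLHS](_ : _ = \int[mu]_(r in `]0%R, 1%R]) (powker a r)%:E)%E
    ?integral_powker01_lty//.
rewrite [RHS]integral_mkcond; apply: eq_integral => x _; rewrite /f patchE.
case: (leP x 1) => x1; case: ifPn => //; rewrite ?inE ?notin_setE/= in_itv/=.
  by rewrite x1 andbT => /negP; rewrite -leNgt => /(powker_npos a) ->.
by rewrite leNgt x1 andbF.
Qed.

Lemma GammaE a : 0 < a <= 1 ->
  (\int[mu]_r (powker a r * expR (- r))%:E)%E = (Gamma a)%:E.
Proof.
move=> a01; rewrite /Gamma /Rintegral.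
rewrite [X in fine X](_ : _ = \int[mu]_r (powker a r * expR (- r))%:E)%E.
  rewrite fineK// ge0_fin_numE ?gamma_integral_lty//.
  by apply: integral_ge0 => x _; rewrite lee_fin mulr_ge0// ?powker_ge0 ?expR_ge0.
rewrite integral_mkcond; apply: eq_integral => x _.
rewrite patchE /powker; case: ifPn.
  by rewrite inE/= in_itv/= andbT => ->.
by rewrite notin_setE/= in_itv/= andbT => /negP/negbTE ->; rewrite mul0r.
Qed.

Lemma Gamma_gt0 a : 0 < a <= 1 -> 0 < Gamma a.
Proof.
move=> a01; have /andP[a0 a1] := a01; rewrite -lte_fin -GammaE//.
apply: (@lt_le_trans _ _ (\int[mu]_(r in `[0%R, 1%R]) (cst (expR (-1))%:E r))%E).
  rewrite integral_cst//= lebesgue_measure_itv/= lte_fin ltr01 -EFinB.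
  by rewrite -EFinM lte_fin subr0 mulr1 expR_gt0.
rewrite -integral_itv_obnd_cbnd; last exact: measurable_cst.
rewrite integral_mkcond; apply: ge0_le_integral => //.
- by move=> x _; rewrite patchE; case: ifP => // _; rewrite lee_fin expR_ge0.
- by apply/(measurable_restrictT (cst (expR (-1))%:E)).
- apply/measurable_EFinP; have := @measurable_powker_exp a 1.
  by under eq_fun do rewrite mul1r.
- move=> x _; rewrite patchE; case: ifPn; last first.
    by rewrite lee_fin mulr_ge0// ?powker_ge0 ?expR_ge0.
  rewrite inE/= in_itv/= => /andP[x0 x1]; rewrite lee_fin powker_pos//.
  rewrite -[leLHS]mul1r ler_pM// ?expR_ge0 ?ler_expR ?lerN2//.
  by rewrite -[leLHS](powRr0 x) ger_powR ?x0// subr_le0.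
Qed.

(** The Laplace transform of the kernel. Its decay in l is what makes the
  Peano-Baker iteration a contraction in an exponentially weighted norm. *)
Lemma laplace_powker a l : 0 < a <= 1 -> 0 < l ->
  (\int[mu]_r (powker a r * expR (- (l * r)))%:E)%E = (l `^ (- a) * Gamma a)%:E.
Proof.
move=> a01 l0; have ln0 : l != 0 by rewrite gt_eqF.
rewrite EFinM -GammaE// (@ge0_integral_affine _ l 0 (fun r => (powker a r * expR (-
    r))%:E))//.
- under [X in _ = (_ * (_ * X))%E]eq_integral => x _.
    rewrite addr0 powker_scale// -mulrA EFinM.
    over.
  rewrite ge0_integralZl//.
  + rewrite muleA muleA -!EFinM gtr0_norm// powRN powRB// ?ln0 ?implybT// powRr1 ?ltW//.
    rewrite [X in (X%:E * _)%E](_ : _ = 1) ?mul1e//.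
    by field; rewrite ln0 gt_eqF// powR_gt0.
  + by apply/measurable_EFinP; exact: measurable_powker_exp.
  + by move=> x _; rewrite lee_fin mulr_ge0// ?powker_ge0 ?expR_ge0.
  + by rewrite lee_fin powR_ge0.
- apply/measurable_EFinP; have := @measurable_powker_exp a 1.
  by under eq_fun do rewrite mul1r.
- by move=> x; rewrite lee_fin mulr_ge0// ?powker_ge0 ?expR_ge0.
Qed.

End power_kernel.

(** * Convolutions of power kernels *)
Section power_convolution.
Context {R : realType}.
Notation mu := (@lebesgue_measure R).
Implicit Types (a b r l s t : R).

(** The weight with which all solutions and kernels are compared. *)
Definition wpowker a l r : R := powker a r * expR (l * r).

Lemma wpowker_ge0 a l r : 0 <= wpowker a l r.
Proof. by rewrite mulr_ge0 ?powker_ge0 ?expR_ge0. Qed.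

Lemma wpowker_npos a l r : r <= 0 -> wpowker a l r = 0.
Proof. by move=> r0; rewrite /wpowker powker_npos// mul0r. Qed.

Lemma measurable_wpowker a l : measurable_fun [set: R] (wpowker a l).
Proof.
apply: measurable_funM; first exact: measurable_powker.
by apply: measurableT_comp.
Qed.

Lemma powR_npow_le r x y : r <= 0 -> 0 < x -> x <= y -> y `^ r <= x `^ r.
Proof.
move=> r0 x0 xy; have y0 := lt_le_trans x0 xy.
rewrite -[r]opprK powRN [leRHS]powRN lef_pV2 ?posrE ?powR_gt0//.
by rewrite ge0_ler_powR ?oppr_ge0 ?nnegrE ?(ltW x0) ?(ltW y0).
Qed.

(** Of v and w, one is at least their half-sum: the corresponding power is
  then at most a power of (v + w) / 2, and the exponential e^(- l w) can be
  given to the other factor, since if v <= w then e^(- l w) <= e^(- l v). *)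
Lemma powker_mul_le a b l v w : a <= 1 -> b <= 1 -> 0 <= l ->
  powker a w * wpowker b l v <= expR (l * (v + w)) *
    (((v + w) / 2) `^ (a - 1) * (powker b v * expR (- (l * v))) +
     ((v + w) / 2) `^ (b - 1) * (powker a w * expR (- (l * w)))).
Proof.
move=> a1 b1 l0.
have rhs_ge0 x y c d : 0 <= expR x * (y `^ c * (powker b v * expR (- (l * v))) +
     y `^ d * (powker a w * expR (- (l * w)))).
  by rewrite !(mulr_ge0, addr_ge0)// ?expR_ge0 ?powR_ge0 ?powker_ge0.
have [w0|w0] := leP w 0; first by rewrite [leLHS](_ : _ = 0)// powker_npos// mul0r.
have [v0|v0] := leP v 0; first by rewrite [leLHS](_ : _ = 0)// wpowker_npos// mulr0.
have h0 : 0 < (v + w) / 2 by rewrite divr_gt0// addr_gt0.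
rewrite /wpowker (_ : expR (l * v) = expR (l * (v + w)) * expR (- (l * w))); last first.
  by rewrite -expRD mulrDr addrK.
rewrite [powker b v * _]mulrCA [powker a w * _]mulrCA ler_wpM2l ?expR_ge0//.
have [vw|wv] := leP v w.
- rewrite -[leLHS]addr0 lerD ?mulr_ge0 ?powR_ge0 ?powker_ge0 ?expR_ge0//.
  rewrite ler_pM ?mulr_ge0 ?powker_ge0 ?expR_ge0//.
    by rewrite powker_pos// powR_npow_le// ?subr_le0//; lra.
  by rewrite ler_wpM2l ?powker_ge0// ler_expR lerN2 ler_wpM2l.
- rewrite -[leLHS]add0r lerD ?mulr_ge0 ?powR_ge0 ?powker_ge0 ?expR_ge0//.
  rewrite mulrCA ler_wpM2r// ?mulr_ge0 ?powker_ge0 ?expR_ge0//.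
  by rewrite powker_pos// powR_npow_le// ?subr_le0//; lra.
Qed.

Lemma measurable_powker_conv a b l s t :
  measurable_fun [set: R] (fun x => powker a (t - x) * wpowker b l (x - s)).
Proof.
apply: measurable_funM.
  apply: (measurableT_comp (measurable_powker a)).
  exact: measurable_funB.
apply: (measurableT_comp (measurable_wpowker b l)).
exact: measurable_funB.
Qed.

Lemma laplace_powker_shift a l s : 0 < a <= 1 -> 0 < l ->
  (\int[mu]_x (powker a (x - s) * expR (- (l * (x - s))))%:E)%E
    = (l `^ (- a) * Gamma a)%:E.
Proof.
move=> a01 l0; rewrite -laplace_powker//.
rewrite [RHS](@ge0_integral_affine _ 1 (- s))//.
- by rewrite normr1 mul1e; apply: eq_integral => x _; rewrite mul1r.
- by apply/measurable_EFinP; exact: measurable_powker_exp.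
- by move=> x; rewrite lee_fin mulr_ge0// ?powker_ge0 ?expR_ge0.
Qed.

Lemma laplace_powker_reflect a l t : 0 < a <= 1 -> 0 < l ->
  (\int[mu]_x (powker a (t - x) * expR (- (l * (t - x))))%:E)%E
    = (l `^ (- a) * Gamma a)%:E.
Proof.
move=> a01 l0; rewrite -laplace_powker//.
rewrite [RHS](@ge0_integral_affine _ (-1) t)//.
- rewrite normrN1 mul1e; apply: eq_integral => x _.
  by rewrite mulN1r [- x + t]addrC.
- by apply/measurable_EFinP; exact: measurable_powker_exp.
- by move=> x; rewrite lee_fin mulr_ge0// ?powker_ge0 ?expR_ge0.
Qed.

Lemma powker_conv_eq0 a b l s t : t <= s ->
  (\int[mu]_x (powker a (t - x) * wpowker b l (x - s))%:E = 0)%E.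
Proof.
move=> ts; rewrite integral0_eq// => x _.
have [xs|sx] := leP x s; first by rewrite wpowker_npos ?mulr0// subr_le0.
by rewrite powker_npos ?mul0r// subr_le0 (le_trans ts)// ltW.
Qed.

Lemma powker_conv_le a b l s t : 0 < a <= 1 -> 0 < b <= 1 -> 0 < l ->
  (\int[mu]_x (powker a (t - x) * wpowker b l (x - s))%:E <=
   (expR (l * (t - s)) *
    (((t - s) / 2) `^ (a - 1) * (l `^ (- b) * Gamma b) +
     ((t - s) / 2) `^ (b - 1) * (l `^ (- a) * Gamma a)))%:E)%E.
Proof.
move=> a01 b01 l0.
have /andP[a0 a1] := a01; have /andP[b0 b1] := b01.
pose F x := powker b (x - s) * expR (- (l * (x - s))).
pose G x := powker a (t - x) * expR (- (l * (t - x))).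
have F0 x : 0 <= F x by rewrite mulr_ge0// ?powker_ge0 ?expR_ge0.
have G0 x : 0 <= G x by rewrite mulr_ge0// ?powker_ge0 ?expR_ge0.
have mF : measurable_fun [set: R] F.
  by apply: (measurableT_comp (measurable_powker_exp b l)); exact: measurable_funB.
have mG : measurable_fun [set: R] G.
  by apply: (measurableT_comp (measurable_powker_exp a l)); exact: measurable_funB.
have cF c : measurable_fun [set: R] (fun x => (c * F x)%:E).
  by apply/measurable_EFinP; exact: measurable_funM.
have cG c : measurable_fun [set: R] (fun x => (c * G x)%:E).
  by apply/measurable_EFinP; exact: measurable_funM.
pose h := t - s.
have hE (x : R) : x - s + (t - x) = h by rewrite /h; ring.
pose cf := expR (l * h) * (h / 2) `^ (a - 1).
pose cg := expR (l * h) * (h / 2) `^ (b - 1).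
have cf0 : 0 <= cf by rewrite mulr_ge0 ?expR_ge0 ?powR_ge0.
have cg0 : 0 <= cg by rewrite mulr_ge0 ?expR_ge0 ?powR_ge0.
apply: (@le_trans _ _ (\int[mu]_x ((cf * F x)%:E + (cg * G x)%:E))%E).
  apply: ge0_le_integral => //.
  - by move=> x _; rewrite lee_fin mulr_ge0 ?powker_ge0 ?wpowker_ge0.
  - by apply/measurable_EFinP; exact: measurable_powker_conv.
  - by apply: emeasurable_funD; [exact: cF|exact: cG].
  - move=> x _; rewrite -EFinD lee_fin.
    rewrite (le_trans (@powker_mul_le _ _ _ _ _ a1 b1 (ltW l0)))//.
    by rewrite hE mulrDr !mulrA.
rewrite ge0_integralD//; first last.
- exact: cG.
- by move=> x _; rewrite lee_fin mulr_ge0.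
- exact: cF.
- by move=> x _; rewrite lee_fin mulr_ge0.
under eq_integral => x _ do rewrite EFinM.
under [X in (_ + X)%E]eq_integral => x _ do rewrite EFinM.
rewrite !ge0_integralZl//; try by [apply/measurable_EFinP|
  move=> x _; rewrite lee_fin].
rewrite /F /G laplace_powker_shift// laplace_powker_reflect//.
by rewrite -!EFinM -EFinD lee_fin mulrDr !mulrA.
Qed.

(** The factor q(l) of the weighted convolution estimate. *)
Definition contraction_rate a l : R := 2 `^ (2 - a) * (l `^ (- a) * Gamma a).

(** For equal exponents the pointwise splitting reproduces the weight itself.
  The exponential weight on one factor only is what produces the small factor
  l^(- a). *)
Lemma wpowker_conv_le a l s t : 0 < a <= 1 -> 0 < l ->
  (\int[mu]_x (powker a (t - x) * wpowker a l (x - s))%:E <=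
   (contraction_rate a l * wpowker a l (t - s))%:E)%E.
Proof.
move=> a01 l0; have [ts|st] := leP t s.
  by rewrite powker_conv_eq0// wpowker_npos ?mulr0// subr_le0.
apply: (le_trans (@powker_conv_le _ _ _ s t a01 a01 l0)).
have h0 : 0 < t - s by rewrite subr_gt0.
rewrite lee_fin /wpowker powker_pos// powRM ?(ltW h0) ?invr_ge0//.
rewrite /contraction_rate (_ : 2 `^ (2 - a) = 2 * 2^-1 `^ (a - 1)); last first.
  rewrite -powR_inv1// -powRrM mulN1r opprB -mulr_powRB1//.
    by congr (_ * _ `^ _); ring.
  by rewrite subr_gt0; case/andP: a01 => _ /le_lt_trans; apply; rewrite ltr1n.
by rewrite le_eqVlt; apply/orP; left; apply/eqP; ring.
Qed.

Lemma powker_conv_lty a b l s t : 0 < a <= 1 -> 0 < b <= 1 -> 0 < l ->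
  (\int[mu]_x (powker a (t - x) * wpowker b l (x - s))%:E < +oo)%E.
Proof. by move=> *; apply: (le_lt_trans (powker_conv_le _ _ _ _ _)) => //; exact: ltry.
    Qed.

Lemma integral_powker1_exp : (\int[mu]_x (powker 1 x * expR (- x))%:E = 1)%E.
Proof.
transitivity (\int[mu]_(x in `]0%R, +oo[) (expR (- x))%:E)%E.
  rewrite [RHS]integral_mkcond; apply: eq_integral => x _.
  rewrite patchE; case: ifPn; rewrite ?inE ?notin_setE/= in_itv/= andbT.
    by move=> x0; rewrite powker_pos// subrr powRr0 mul1r.
  by move=> /negP; rewrite -leNgt => x0; rewrite powker_npos// mul0r.
rewrite integral_itv_obnd_cbnd; last first.
  by apply/measurable_EFinP; apply: measurable_funTS; exact: measurableT_comp.
rewrite -(@integral_exponential_pdf R 1 ltr01) integral_mkcond.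
apply: eq_integral => x _; rewrite patchE /exponential_pdf patchE.
by case: ifP => // _; rewrite mul1r mulN1r.
Qed.

(** Euler's identity B(1 - a, a) = Gamma(1 - a) Gamma(a), on any interval. By
  scaling the left side does not depend on s < t; call it B. Writing
  Gamma(1 - a) Gamma(a) as a double integral in (x - y, y) and integrating first
  in y gives the integral of B e^(- x) over x > 0, which is B. *)
Lemma powker_conv_beta a s t : 0 < a < 1 -> s < t ->
  (\int[mu]_x (powker (1 - a) (t - x) * powker a (x - s))%:E
    = (Gamma (1 - a) * Gamma a)%:E)%E.
Proof.
move=> /andP[a0 a1] st.
have a01 : 0 < a <= 1 by rewrite a0 ltW.
have b01 : 0 < 1 - a <= 1 by rewrite subr_gt0 a1 gerBl ltW.
have mc u v : measurable_fun [set: R] (fun x => (powker (1 - a) (u - x) * powker a (x -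
    v))%:E).
  apply/measurable_EFinP; have := @measurable_powker_conv (1 - a) a 0 v u.
  by rewrite /wpowker; under eq_fun do rewrite mul0r expR0 mulr1.
(* the exponents - a and a - 1 of the two kernels add up to -1, the Jacobian to 1 *)
have scal u v : u < v -> (\int[mu]_x (powker (1 - a) (v - x) * powker a (x - u))%:E =
    \int[mu]_x (powker (1 - a) (1 - x) * powker a x)%:E)%E.
  move=> uv; have h0 : 0 < v - u by rewrite subr_gt0.
  have vE (x : R) : v - ((v - u) * x + u) = (v - u) * (1 - x) by ring.
  rewrite (@ge0_integral_affine _ (v - u) u)//; first last.
  - by move=> x; rewrite lee_fin mulr_ge0// powker_ge0.
  - by rewrite gt_eqF.
  rewrite gtr0_norm// -ge0_integralZl//; first last.
  - by rewrite lee_fin ltW.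
  - by move=> x _; rewrite lee_fin mulr_ge0// powker_ge0.
  - by apply: (measurableT_comp (mc v u)); apply: measurable_funD.
  apply: eq_integral => x _; rewrite -EFinM; congr EFin.
  rewrite vE.
  rewrite addrK !powker_scale// mulrACA mulrA -powRD; last first.
    by apply/implyP => _; rewrite gt_eqF.
  rewrite (_ : 1 - a - 1 + (a - 1) = -1); last by ring.
  by rewrite powR_inv1 ?(ltW h0)// !mulrA mulfV ?gt_eqF// mul1r.
rewrite scal//; set B := (LHS in LHS = _).
(* the integrand of Gamma(1 - a) Gamma(a) in the variables (sum, second factor) *)
pose f (p : R * R) : \bar R :=
  ((powker (1 - a) (p.1 - p.2) * expR (- (p.1 - p.2))) * (powker a p.2 * expR (-
      p.2)))%:E.
have f0 p : (0 <= f p)%E.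
  by rewrite lee_fin !mulr_ge0// ?powker_ge0// ?expR_ge0.
have mpe b : measurable_fun [set: R] (fun x => powker b x * expR (- x)).
  have := @measurable_powker_exp _ b 1.
  by under eq_fun do rewrite mul1r.
have mf : measurable_fun [set: R * R] f.
  apply/measurable_EFinP; apply: measurable_funM.
    by apply: (measurableT_comp (mpe _)); exact: measurable_funB.
  by apply: (measurableT_comp (mpe _)).
have := @fubini_tonelli _ _ _ _ _ mu mu f mf f0.
rewrite /f/=; under [X in _ = X]eq_integral => x _.
  under eq_integral => y _ do rewrite mulrC EFinM.
  rewrite ge0_integralZl//; last 3 first.
  - apply/measurable_EFinP; apply: (measurableT_comp (mpe _)).
    exact: measurable_funB.
  - by move=> y _; rewrite lee_fin mulr_ge0 ?powker_ge0 ?expR_ge0.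
  - by rewrite lee_fin mulr_ge0 ?powker_ge0 ?expR_ge0.
  under eq_integral => y _ do rewrite -[in expR _](mul1r (_ - _)).
  rewrite laplace_powker_shift// powR1 mul1r.
  over.
rewrite ge0_integralZr//; last 3 first.
- by apply/measurable_EFinP; exact: mpe.
- by move=> y _; rewrite lee_fin mulr_ge0 ?powker_ge0 ?expR_ge0.
- by rewrite lee_fin ltW// Gamma_gt0.
rewrite GammaE// -EFinM [Gamma a * _]mulrC => <-.
have B0 : (0 <= B)%E by apply: integral_ge0 => x _; rewrite lee_fin mulr_ge0 ?powker_ge0.
transitivity (\int[mu]_x ((powker 1 x * expR (- x))%:E * B))%E.
  rewrite ge0_integralZr//.
  - by rewrite integral_powker1_exp mul1e.
  - by apply/measurable_EFinP; exact: mpe.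
  - by move=> x _; rewrite lee_fin mulr_ge0 ?powker_ge0 ?expR_ge0.
apply: eq_integral => x _.
transitivity ((expR (- x))%:E * \int[mu]_y (powker (1 - a) (x - y) * powker a (y -
    0))%:E)%E.
  have [x0|x0] := leP x 0.
    rewrite powker_npos// mul0r mul0e [X in (_ * X)%E](_ : _ = 0%E) ?mule0//.
    rewrite -(@powker_conv_eq0 (1 - a) a 0 _ _ x0).
    by apply: eq_integral => y _; rewrite /wpowker mul0r expR0 mulr1.
  rewrite scal// powker_pos// subrr powRr0 mul1r.
  by [].
rewrite -ge0_integralZl//; first last.
- by move=> y _; rewrite lee_fin mulr_ge0 ?powker_ge0.
- exact: mc.
apply: eq_integral => y _; rewrite -EFinM subr0; congr EFin.
have -> : - x = - (x - y) - y by ring.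
by rewrite expRD; ring.
Qed.
End power_convolution.

(** * Integrals of dominated products *)
Section measurability.
Context d (T : measurableType d) {R : realType}.
Notation mu := (@lebesgue_measure R).

Lemma measurable_Rintegral_param (f : T * R -> R) :
  measurable_fun [set: T * R] f ->
  measurable_fun [set: T] (fun x => \int[mu]_y f (x, y)).
Proof.
move=> mf; have mfE : measurable_fun [set: T * R] (EFin \o f).
  exact/measurable_EFinP.
rewrite (_ : (fun x => _) = fine \o (fun x => \int[mu]_y (EFin \o f)^\+ (x, y) -
    \int[mu]_y (EFin \o f)^\- (x, y))%E); last first.
  apply/funext => x; rewrite /= /Rintegral integralE; congr fine.
  by congr (_ - _)%E; apply: eq_integral => y _; rewrite ?funeposE ?funenegE.
apply: measurableT_comp; first exact: fine_measurable.
apply: emeasurable_funB.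
- apply: (measurable_fun_fubini_tonelli_F (m2 := mu) (EFin \o f)^\+%E) => //.
  exact: measurable_funepos.
- apply: (measurable_fun_fubini_tonelli_F (m2 := mu) (EFin \o f)^\-%E) => //.
  exact: measurable_funeneg.
Qed.

End measurability.

Section dominated_integrals.
Context {R : realType}.
Notation mu := (@lebesgue_measure R).
Variables (a l : R).
Hypotheses (a01 : 0 < a <= 1) (l0 : 0 < l).
Implicit Types (K g : R -> R) (b c s t : R).

Lemma measurable_section1 (L : R * R -> R) x : measurable_fun [set: R * R] L ->
  measurable_fun [set: R] (fun y => L (x, y)).
Proof. by move=> mL; apply: (measurableT_comp mL); exact: measurable_pair1. Qed.

Lemma measurable_section2 (L : R * R -> R) y : measurable_fun [set: R * R] L ->
  measurable_fun [set: R] (fun x => L (x, y)).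
Proof. by move=> mL; apply: (measurableT_comp mL); exact: measurable_pair2. Qed.

Lemma powker_le_wpowker x : powker a x <= wpowker a l x.
Proof.
have [x0|x0] := leP x 0; first by rewrite powker_npos// wpowker_npos.
by rewrite /wpowker ler_peMr ?powker_ge0// -expR0 ler_expR mulr_ge0// ltW.
Qed.

(** To the right of s the exponential factor is bounded for fixed t, so a kernel
  bounded by the weight can be used where a bound by the pure power is asked. *)
Lemma wpowker_le_powker s t x : s <= x -> wpowker a l (t - x) <= expR (l * `|t - s|) *
    powker a (t - x).
Proof.
move=> sx; have [tx|tx] := leP (t - x) 0.
  by rewrite powker_npos// wpowker_npos// mulr0.
rewrite /wpowker mulrC ler_wpM2r ?powker_ge0// ler_expR ler_wpM2l ?(ltW l0)//.
by rewrite (le_trans _ (ler_norm _))// lerD2l lerN2.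
Qed.

(** The common situation of the proof: a kernel section with a power singularity
  at t times data with a power singularity at s. The bound on K is asked only to
  the right of s, where g does not vanish. *)
Section product.
Variables (b c1 c2 s t : R) (K g : R -> R).
Hypotheses (b01 : 0 < b <= 1) (c10 : 0 <= c1) (c20 : 0 <= c2).
Hypotheses (mK : measurable_fun [set: R] K) (mg : measurable_fun [set: R] g).
Hypothesis Kle : forall x, s < x -> `|K x| <= c1 * powker b (t - x).
Hypothesis gle : forall x, `|g x| <= c2 * wpowker a l (x - s).

Let Kg_le x : `|K x * g x| <= (c1 * c2) * (powker b (t - x) * wpowker a l (x - s)).
Proof.
rewrite normrM mulrACA; have [xs|sx] := leP x s.
  have := gle x; rewrite wpowker_npos ?subr_le0// mulr0 normr_le0 => /eqP ->.
  by rewrite normr0 !mulr0.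
by rewrite ler_pM ?Kle.
Qed.

Let mKg : measurable_fun [set: R] (fun x => K x * g x).
Proof. exact: measurable_funM. Qed.

Lemma integral_abs_dominated :
  (\int[mu]_x `|(K x * g x)%:E| <=
   (c1 * c2)%:E * \int[mu]_x (powker b (t - x) * wpowker a l (x - s))%:E)%E.
Proof.
rewrite -ge0_integralZl//; first last.
- by rewrite lee_fin mulr_ge0.
- by move=> x _; rewrite lee_fin mulr_ge0 ?powker_ge0 ?wpowker_ge0.
- by apply/measurable_EFinP; exact: measurable_powker_conv.
apply: ge0_le_integral => //.
- by apply: measurableT_comp => //; exact/measurable_EFinP.
- apply/measurable_EFinP; apply: measurable_funM => //; exact: measurable_powker_conv.
- by move=> x _; rewrite -EFinM abse_EFin lee_fin.
Qed.

Lemma integrable_dominated : mu.-integrable [set: R] (EFin \o (fun x => K x * g x)).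
Proof.
apply/integrableP; split; first exact/measurable_EFinP.
apply: (le_lt_trans integral_abs_dominated).
by rewrite lte_mul_pinfty// ?lee_fin ?mulr_ge0// powker_conv_lty.
Qed.

Lemma Rintegral_dominated V :
  (\int[mu]_x (powker b (t - x) * wpowker a l (x - s))%:E <= V%:E)%E ->
  `|\int[mu]_x (K x * g x)| <= c1 * c2 * V.
Proof.
move=> VE; rewrite -lee_fin EFin_normr_Rintegral//; last exact: integrable_dominated.
apply: (le_trans (le_abse_integral _ _ _)) => //; first exact/measurable_EFinP.
apply: (le_trans integral_abs_dominated).
by rewrite (EFinM _ V) lee_wpmul2l// lee_fin mulr_ge0.
Qed.

End product.

(** Associativity of the composition of Volterra kernels, acting on data g. The
  integrand vanishes unless s < y < x < t, where the weight on L costs at most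
  the constant factor e; integrating in y and then in x is then covered by
  [wpowker_conv_le] and [powker_conv_lty]. Integrability of the two iterated
  integrands is part of the conclusion because sums of such terms occur. *)
Lemma Fubini_dominated b c1 c2 c3 s t K (L : R * R -> R) g :
  0 < b <= 1 -> 0 <= c1 -> 0 <= c2 -> 0 <= c3 ->
  measurable_fun [set: R] K -> measurable_fun [set: R * R] L ->
  measurable_fun [set: R] g ->
  (forall x, s < x -> `|K x| <= c1 * powker b (t - x)) ->
  (forall x y, s < y -> `|L (x, y)| <= c2 * wpowker a l (x - y)) ->
  (forall y, `|g y| <= c3 * wpowker a l (y - s)) ->
  [/\ mu.-integrable [set: R] (EFin \o (fun x => K x * \int[mu]_y (L (x, y) * g y))),
      mu.-integrable [set: R] (EFin \o (fun y => (\int[mu]_x (K x * L (x, y))) * g y)) &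
      \int[mu]_x (K x * \int[mu]_y (L (x, y) * g y)) =
      \int[mu]_y ((\int[mu]_x (K x * L (x, y))) * g y)].
Proof.
move=> b01 c10 c20 c30 mK mL mg Kle Lle gle.
pose f (p : R * R) : \bar R := (K p.1 * (L p * g p.2))%:E.
have mf : measurable_fun [set: R * R] f.
  apply/measurable_EFinP; apply: measurable_funM; first exact: measurableT_comp.
  by apply: measurable_funM => //; exact: measurableT_comp.
have g0 y : y <= s -> g y = 0.
  move=> ys; have := gle y.
  by rewrite wpowker_npos ?subr_le0// mulr0 normr_le0 => /eqP.
pose e s t := expR (l * `|t - s|).
have e0 u v : 0 <= e u v by exact: expR_ge0.
have Lle' x y : s < y -> `|L (x, y)| <= c2 * e s x * powker a (x - y).
  move=> sy; apply: (le_trans (Lle x y sy)); rewrite -mulrA ler_wpM2l//.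
  by apply: wpowker_le_powker; exact: ltW.
have iLg x : mu.-integrable [set: R] (EFin \o (fun y => L (x, y) * g y)).
  apply: (@integrable_dominated a (c2 * e s x) c3 s x) => //.
  - by rewrite mulr_ge0.
  - exact: measurable_section1.
  - by move=> y /Lle'.
have iKL y : s < y -> mu.-integrable [set: R] (EFin \o (fun x => K x * L (x, y))).
  move=> sy; apply: (@integrable_dominated b c1 c2 y t) => //.
  - exact: measurable_section2.
  - by move=> x yx; apply: Kle; exact: lt_trans yx.
  - by move=> x; exact: Lle.
have fint : (mu \x mu)%E.-integrable setT f.
  apply/integrable12ltyP => //.
  pose C := c1 * (c2 * e s t * c3).
  have C0 : 0 <= C by rewrite !mulr_ge0.
  pose q := contraction_rate a l.
  apply: (@le_lt_trans _ _ (\int[mu]_x (C%:E * (q%:E * (powker b (t - x) * wpowker a l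
      (x - s))%:E)))%E).
    have q0 : 0 <= q.
      by rewrite /q /contraction_rate !mulr_ge0 ?powR_ge0// ltW// Gamma_gt0.
    apply: ge0_le_integral => //.
    - by move=> x _; exact: integral_ge0.
    - apply: (measurable_fun_fubini_tonelli_F (m2 := mu) (abse \o f)).
        exact: measurableT_comp.
      by move=> p; exact: abse_ge0.
    - apply/measurable_EFinP; apply: (measurable_funM (f := cst C)) => //.
      by apply: (measurable_funM (f := cst q)) => //; exact: measurable_powker_conv.
    - move=> x _.
      apply: (@le_trans _ _ (\int[mu]_y ((C * powker b (t - x))%:E * (powker a (x - y)
          * wpowker a l (y - s))%:E))%E).
        apply: ge0_le_integral => //.
        + apply: measurableT_comp => //.
          by apply: (measurableT_comp mf); exact: measurable_pair1.
        + apply/measurable_EFinP.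
          apply: (measurable_funM (f := cst (C * powker b (t - x)))) => //.
          exact: measurable_powker_conv.
        + move=> y _; rewrite /f abse_EFin lee_fin.
          have rhs0 : 0 <= C * powker b (t - x) * (powker a (x - y) * wpowker a l (y -
              s)).
            by rewrite !mulr_ge0 ?powker_ge0 ?wpowker_ge0.
          have [ys|sy] := leP y s; first by rewrite g0// !mulr0 normr0.
          have [xy|yx] := leP x y.
            have := Lle x y sy; rewrite wpowker_npos ?subr_le0// mulr0 normr_le0.
            by move=> /eqP ->; rewrite mul0r mulr0 normr0.
          have [tx|xt] := leP t x.
            have K0 : K x = 0.
              have := Kle x (lt_trans sy yx).
              by rewrite powker_npos ?subr_le0// mulr0 normr_le0 => /eqP.
            by rewrite K0 mul0r normr0.
          rewrite !normrM.
          rewrite (_ : C * _ * _ = (c1 * powker b (t - x)) *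
             ((c2 * e s t * powker a (x - y)) * (c3 * wpowker a l (y - s)))); last by
                 rewrite /C; ring.
          have sx := lt_trans sy yx.
          rewrite ler_pM ?mulr_ge0// ?Kle// ler_pM// (le_trans (Lle' x y sy))//.
          rewrite ler_wpM2r ?powker_ge0// ler_wpM2l// ler_expR ler_wpM2l ?(ltW l0)//.
          by rewrite !gtr0_norm ?subr_gt0//; [rewrite lerB// ltW|exact: lt_trans xt].
      rewrite ge0_integralZl//; first last.
      + by rewrite lee_fin mulr_ge0 ?powker_ge0.
      + by move=> y _; rewrite lee_fin mulr_ge0 ?powker_ge0 ?wpowker_ge0.
      + by apply/measurable_EFinP; exact: measurable_powker_conv.
      have Cp : (0 <= (C * powker b (t - x))%:E)%E by rewrite lee_fin mulr_ge0
          ?powker_ge0.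
      apply: (le_trans (lee_wpmul2l Cp (wpowker_conv_le s x a01 l0))).
      by rewrite -!EFinM lee_fin le_eqVlt; apply/orP; left; apply/eqP; rewrite /q; ring.
  under eq_integral do rewrite -!EFinM mulrA EFinM.
  rewrite ge0_integralZl//; first last.
  - by rewrite lee_fin mulr_ge0// /q /contraction_rate !mulr_ge0 ?powR_ge0// ltW//
      Gamma_gt0.
  - by move=> x _; rewrite lee_fin mulr_ge0 ?powker_ge0 ?wpowker_ge0.
  - by apply/measurable_EFinP; exact: measurable_powker_conv.
  rewrite lte_mul_pinfty// ?powker_conv_lty//.
  by rewrite lee_fin mulr_ge0// /q /contraction_rate !mulr_ge0 ?powR_ge0// ltW//
      Gamma_gt0.
have FE x : (K x * \int[mu]_y (L (x, y) * g y))%:E = (\int[mu]_y f (x, y))%E.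
  rewrite -RintegralZl// fineK//.
  apply: integrable_fin_num => //.
  have := integrableZl measurableT (K x) (iLg x).
  by apply: eq_integrable => // y _; rewrite /= EFinM.
have GE y : ((\int[mu]_x (K x * L (x, y))) * g y)%:E = (\int[mu]_x f (x, y))%E.
  have [ys|sy] := leP y s.
    by rewrite g0// mulr0 integral0_eq// => x _; rewrite /f/= g0// !mulr0.
  rewrite -RintegralZr//; last exact: iKL.
  rewrite fineK.
    by apply: eq_integral => x _; rewrite /f/= mulrA.
  apply: integrable_fin_num => //.
  have := integrableZr measurableT (g y) (iKL y sy).
  by apply: eq_integrable => // x _; rewrite /= EFinM.
split.
- by apply: eq_integrable (integrable_fubini_F fint) => // x _; rewrite /= FE.
- have fswap : (mu \x mu)%E.-integrable setT (fun p : R * R => f (p.2, p.1)).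
    have mfs : measurable_fun [set: R * R] (fun p : R * R => f (p.2, p.1)).
      by apply: (measurableT_comp mf); exact: measurable_fun_pair.
    by apply/(integrable12ltyP mu mu mfs); have /(integrable21ltyP mu mu mf) := fint.
  by apply: eq_integrable (integrable_fubini_F fswap) => // y _; rewrite /= GE.
- have := Fubini fint; rewrite /fubini_F /fubini_G => FF.
  rewrite /Rintegral; congr fine.
  under eq_integral do rewrite FE.
  under [RHS]eq_integral do rewrite GE.
  by [].
Qed.

End dominated_integrals.

(** * Matrix-valued integrals over the line *)
Section matrix_integral.
Context {R : realType}.
Notation mu := (@lebesgue_measure R).

Definition mx_Rint {m p} (f : R -> 'M[R]_(m, p)) : 'M[R]_(m, p) :=
  \matrix_(i, j) \int[mu]_x f x i j.

Definition mx_measurable {d} {T : measurableType d} {m p} (f : T -> 'M[R]_(m, p)) :=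
  forall i j, measurable_fun [set: T] (fun x => f x i j).

Definition mx_bounded_by {T} {m p} (f : T -> 'M[R]_(m, p)) (w : T -> R) :=
  forall x i j, `|f x i j| <= w x.

Definition mx_integrableT {m p} (f : R -> 'M[R]_(m, p)) :=
  forall i j, mu.-integrable [set: R] (EFin \o (fun x => f x i j)).

Lemma Rintegral_sum (I : Type) (r : seq I) (h : I -> R -> R) :
  (forall i, mu.-integrable [set: R] (EFin \o h i)) ->
  mu.-integrable [set: R] (EFin \o (fun x => \sum_(i <- r) h i x)) /\
  \int[mu]_x (\sum_(i <- r) h i x) = \sum_(i <- r) \int[mu]_x h i x.
Proof.
move=> ih; elim: r => [|i r [IHi IHe]].
  rewrite big_nil; split.
    rewrite (_ : _ \o _ = cst 0%E); first exact: integrable0.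
    by apply/funext => x /=; rewrite big_nil.
  by under eq_Rintegral do rewrite big_nil; rewrite /Rintegral integral0.
rewrite big_cons; under eq_Rintegral do rewrite big_cons; split.
  rewrite (_ : _ \o _ = ((EFin \o h i) \+ (EFin \o (fun x => (\sum_(i <- r) h i
      x)%R)))%E).
    exact: integrableD.
  by apply/funext => x /=; rewrite big_cons EFinD.
by rewrite RintegralD// IHe.
Qed.

Lemma eq_mx_Rint {m p} (f g : R -> 'M[R]_(m, p)) : f =1 g -> mx_Rint f = mx_Rint g.
Proof. by move=> fg; congr mx_Rint; exact/funext. Qed.

Lemma mx_RintD {m p} (f g : R -> 'M[R]_(m, p)) :
  mx_integrableT f -> mx_integrableT g ->
  mx_Rint (fun x => f x + g x) = mx_Rint f + mx_Rint g.
Proof.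
move=> fi gi; apply/matrixP => i j; rewrite !mxE -RintegralD//.
by under eq_Rintegral do rewrite mxE.
Qed.

Lemma mx_RintB {m p} (f g : R -> 'M[R]_(m, p)) :
  mx_integrableT f -> mx_integrableT g ->
  mx_Rint (fun x => f x - g x) = mx_Rint f - mx_Rint g.
Proof.
move=> fi gi; apply/matrixP => i j; rewrite !mxE -RintegralB//.
by under eq_Rintegral do rewrite !mxE.
Qed.

Lemma mx_Rint0 {m p} : mx_Rint (fun=> 0 : 'M[R]_(m, p)) = 0.
Proof.
apply/matrixP => i j; rewrite !mxE /Rintegral.
by rewrite integral0_eq// => x _; rewrite mxE.
Qed.

Lemma mx_Rint_mulmxr {m n p} (f : R -> 'M[R]_(m, n)) (B : 'M[R]_(n, p)) :
  mx_integrableT f ->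
  mx_integrableT (fun x => f x *m B) /\ mx_Rint (fun x => f x *m B) = mx_Rint f *m B.
Proof.
move=> fi.
have ih i j k : mu.-integrable [set: R] (EFin \o (fun x => f x i k * B k j)).
  have := integrableZr measurableT (B k j) (fi i k).
  by apply: eq_integrable => // x _; rewrite /= EFinM.
split.
  move=> i j; have [+ _] := Rintegral_sum (index_enum _) (ih i j).
  by apply: eq_integrable => // x _; rewrite /= mxE.
apply/matrixP => i j; rewrite !mxE.
under eq_Rintegral do rewrite mxE.
have [_ ->] := Rintegral_sum (index_enum _) (ih i j).
by apply: eq_bigr => k _; rewrite mxE RintegralZr.
Qed.

End matrix_integral.

Section matrix_kernels.
Context {R : realType}.
Notation mu := (@lebesgue_measure R).
Variables (a l : R).
Hypotheses (a01 : 0 < a <= 1) (l0 : 0 < l).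
Implicit Types (b c s t : R).

Section mulmx_dominated.
Context {m n p : nat}.
Variables (b c1 c2 s t : R) (K : R -> 'M[R]_(m, n)) (g : R -> 'M[R]_(n, p)).
Hypotheses (b01 : 0 < b <= 1) (c10 : 0 <= c1) (c20 : 0 <= c2).
Hypotheses (mK : mx_measurable K) (mg : mx_measurable g).
Hypothesis Kle : forall x i j, s < x -> `|K x i j| <= c1 * powker b (t - x).
Hypothesis gle : mx_bounded_by g (fun x => c2 * wpowker a l (x - s)).

Let ientry i k j : mu.-integrable [set: R] (EFin \o (fun x => K x i k * g x k j)).
Proof.
apply: (@integrable_dominated _ a l a01 l0 b c1 c2 s t) => //.
by move=> x sx; exact: Kle.
Qed.

Lemma mx_integrable_dominated : mx_integrableT (fun x => K x *m g x).
Proof.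
move=> i j; have [+ _] := Rintegral_sum (index_enum _) (fun k => ientry i k j).
by apply: eq_integrable => // x _; rewrite /= mxE.
Qed.

Lemma mx_Rint_mulmxE i j :
  mx_Rint (fun x => K x *m g x) i j = \sum_k \int[mu]_x (K x i k * g x k j).
Proof.
rewrite mxE; under eq_Rintegral do rewrite mxE.
by have [_ ->] := Rintegral_sum (index_enum _) (fun k => ientry i k j).
Qed.

Lemma mx_Rint_dominated V i j :
  (\int[mu]_x (powker b (t - x) * wpowker a l (x - s))%:E <= V%:E)%E ->
  `|mx_Rint (fun x => K x *m g x) i j| <= n%:R * (c1 * c2 * V).
Proof.
move=> VE; rewrite mx_Rint_mulmxE (le_trans (ler_norm_sum _ _ _))//.
rewrite (le_trans (ler_sum _ (G := fun=> c1 * c2 * V) _))//.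
  move=> k _; apply: (@Rintegral_dominated _ a l a01 l0 b c1 c2 s t) => //.
  by move=> x sx; exact: Kle.
by rewrite sumr_const card_ord mulr_natl.
Qed.

End mulmx_dominated.

Lemma mx_wpowker_le_powker {m p} c s t (L : R -> R -> 'M[R]_(m, p)) x i j : 0 <= c ->
  (forall x y i j, `|L x y i j| <= c * wpowker a l (x - y)) ->
  s < x -> `|L t x i j| <= c * expR (l * `|t - s|) * powker a (t - x).
Proof.
move=> c0 Lle sx; apply: (le_trans (Lle _ _ _ _)).
by rewrite -mulrA ler_wpM2l// wpowker_le_powker// ltW.
Qed.

(** Entrywise, both sides are the same double sum of scalar iterated integrals. *)
Lemma mx_Fubini_dominated {m n p q} b c1 c2 c3 s t (K : R -> 'M[R]_(m, n))
    (L : R -> R -> 'M[R]_(n, p)) (g : R -> 'M[R]_(p, q)) :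
  0 < b <= 1 -> 0 <= c1 -> 0 <= c2 -> 0 <= c3 ->
  mx_measurable K -> mx_measurable (fun z : R * R => L z.1 z.2) ->
  mx_measurable g ->
  (forall x i j, s < x -> `|K x i j| <= c1 * powker b (t - x)) ->
  (forall x y i j, `|L x y i j| <= c2 * wpowker a l (x - y)) ->
  mx_bounded_by g (fun x => c3 * wpowker a l (x - s)) ->
  mx_Rint (fun x => K x *m mx_Rint (fun y => L x y *m g y)) =
  mx_Rint (fun y => mx_Rint (fun x => K x *m L x y) *m g y).
Proof.
move=> b01 c10 c20 c30 mK mL mg Kle Lle gle.
have mL1 x : mx_measurable (L x).
  by move=> i j; exact: (measurable_section1 x (mL i j)).
have mL2 y : mx_measurable (L ^~ y).
  by move=> i j; exact: (measurable_section2 y (mL i j)).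
have LE x i j : mx_Rint (fun y => L x y *m g y) i j = \sum_k \int[mu]_y (L x y i k * g
    y k j).
  apply: (@mx_Rint_mulmxE _ _ _ a (c2 * expR (l * `|x - s|)) c3 s x) => //.
  - by rewrite mulr_ge0 ?expR_ge0.
  - by move=> y i' j' sy; exact: mx_wpowker_le_powker.
have FF i k h j := @Fubini_dominated _ a l a01 l0 b c1 c2 c3 s t (fun x => K x i k)
  (fun z => L z.1 z.2 k h) (fun y => g y h j) b01 c10 c20 c30 (mK i k) (mL k h) (mg h j)
  (fun x => Kle x i k) (fun x y _ => Lle x y k h) (fun y => gle y h j).
have iKL y i j : s < y -> mx_Rint (fun x => K x *m L x y) i j =
    \sum_k \int[mu]_x (K x i k * L x y k j).
  move=> sy; apply: (@mx_Rint_mulmxE _ _ _ b c1 c2 y t) => //.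
  by move=> x i' j' yx; apply: Kle; exact: lt_trans yx.
have g0 y h j : y <= s -> g y h j = 0.
  move=> ys; have := gle y h j.
  by rewrite wpowker_npos ?subr_le0// mulr0 normr_le0 => /eqP.
apply/matrixP => i j; rewrite [LHS]mxE [RHS]mxE.
transitivity (\sum_k \sum_h \int[mu]_x (K x i k * \int[mu]_y (L x y k h * g y h j))).
  under eq_Rintegral => x _.
    rewrite mxE; under eq_bigr do rewrite LE mulr_sumr.
    over.
  have in2 k : mu.-integrable [set: R] (EFin \o (fun x =>
      \sum_h (K x i k * \int[mu]_y (L x y k h * g y h j)))).
    by apply: (Rintegral_sum _ _).1 => h; have [] := FF i k h j.
  rewrite (Rintegral_sum _ in2).2; apply: eq_bigr => k _.
  by apply: (Rintegral_sum _ _).2 => h; have [] := FF i k h j.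
rewrite exchange_big/=.
transitivity (\sum_h \sum_k \int[mu]_y ((\int[mu]_x (K x i k * L x y k h)) * g y h j)).
  by apply: eq_bigr => h _; apply: eq_bigr => k _; have [] := FF i k h j.
under [RHS]eq_Rintegral => y _.
  rewrite mxE (eq_bigr (fun h => \sum_k (\int[mu]_x (K x i k * L x y k h)) * g y h j)).
    over.
  move=> h _; have [ys|sy] := leP y s.
    by rewrite g0// mulr0 big1// => k _; rewrite mulr0.
  by rewrite iKL// mulr_suml.
have in2 h : mu.-integrable [set: R] (EFin \o (fun y =>
    \sum_k ((\int[mu]_x (K x i k * L x y k h)) * g y h j))).
  by apply: (Rintegral_sum _ _).1 => k; have [] := FF i k h j.
rewrite (Rintegral_sum _ in2).2; apply: eq_bigr => h _.
by rewrite (Rintegral_sum _ _).2// => k; have [] := FF i k h j.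
Qed.

End matrix_kernels.

(** * Geometric convergence *)
Section geometric_series.
Context {R : realType}.

Lemma geometric_tail (u : R^nat) C : (forall k, `|u k| <= C * 2^-1 ^+ k) ->
  cvgn (series u) /\
  forall N, `|limn (series u) - series u N| <= 2 * C * 2^-1 ^+ N.
Proof.
move=> uC; have half1 : `|2^-1 : R| < 1 by rewrite ger0_norm ?invr_ge0// invf_lt1// ltr1n.
have tail N m : `|series u (N + m)%N - series u N| <= 2 * C * 2^-1 ^+ N - 2 * C * 2^-1
    ^+ (N + m).
  elim: m => [|m IH]; first by rewrite addn0 !subrr normr0.
  rewrite addnS seriesSr /= (_ : _ + _ - _ = (series u (N + m)%N - series u N) + u (N +
      m)%N); last by rewrite addrAC.
  rewrite (le_trans (ler_normD _ _))// (le_trans (lerD IH (uC _)))//.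
  by rewrite exprS; lra.
have cu : cvgn (series u).
  apply: normed_cvg; apply: (@series_le_cvg _ _ (geometric C 2^-1)) => //.
  - by move=> k; rewrite /= normr_ge0.
  - by move=> k; rewrite /geometric/= (le_trans _ (uC k)).
  - exact: is_cvg_geometric_series.
split=> // N.
have cN : (fun m => `|series u (m + N)%N - series u N|) @ \oo --> `|limn (series u) -
    series u N|.
  apply: cvg_norm; apply: cvgB; last exact: cvg_cst.
  by rewrite (cvg_shiftn N (series u) _).
rewrite -(cvg_lim _ cN)//; apply: limr_le; first by apply/cvg_ex; eexists; exact: cN.
apply: nearW => m; rewrite addnC (le_trans (tail _ _))// gerBl.
have := le_trans (normr_ge0 _) (uC 0%N); rewrite expr0 mulr1 => C0.
by rewrite mulr_ge0 ?mulr_ge0 ?exprn_ge0 ?invr_ge0.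
Qed.

Lemma eq0_geometric (x C : R) : (forall N, `|x| <= C * 2^-1 ^+ N) -> x = 0.
Proof.
move=> xC; apply/eqP; rewrite -normr_le0.
have half1 : `|2^-1 : R| < 1 by rewrite ger0_norm ?invr_ge0// invf_lt1// ltr1n.
have cC : (fun N => C * 2^-1 ^+ N) @ \oo --> (0 : R).
  exact: cvg_geometric.
rewrite -(cvg_lim _ cC)//; apply: limr_ge; first by apply/cvg_ex; exists 0.
by apply: nearW => N; exact: xC.
Qed.

(** The rate is a constant times l^(- a). *)
Lemma contraction_rate_small (a e : R) : 0 < a <= 1 -> 0 < e ->
  exists2 l : R, 0 < l & contraction_rate a l <= e.
Proof.
move=> a01 e0; have /andP[a0 _] := a01.
pose B := 2 `^ (2 - a) * Gamma a.
have B0 : 0 < B by rewrite mulr_gt0 ?powR_gt0 ?Gamma_gt0.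
exists ((e / B) `^ (- a^-1)); first by rewrite powR_gt0// divr_gt0.
rewrite /contraction_rate -powRrM mulrNN mulVf ?gt_eqF// powRr1; last by rewrite ltW//
    divr_gt0.
rewrite mulrCA -/B divfK ?gt_eqF//.
Qed.

End geometric_series.

(** * The Peano-Baker series of a bounded coefficient *)
Section peano_baker.
Context {R : realType} {n : nat}.
Notation mu := (@lebesgue_measure R).
Variables (a l cA : R) (A : R -> 'M[R]_n).
Hypotheses (a01 : 0 < a <= 1) (l0 : 0 < l) (cA0 : 0 <= cA).
Hypotheses (mA : mx_measurable A) (Ale : mx_bounded_by A (fun=> cA)).
(* l is large enough for the composition with [volterra_kernel] to halve any
   bound by the weight; n comes from the sum in the matrix product *)
Hypothesis small : n%:R * (cA / Gamma a * contraction_rate a l) <= 2^-1.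

Let G0 : 0 < Gamma a. Proof. exact: Gamma_gt0. Qed.

(** The kernel of the operator f |-> J^a (A f). *)
Definition volterra_kernel (t s : R) : 'M[R]_n := (powker a (t - s) / Gamma a) *: A s.

(** The terms of the series, as kernels on the whole plane that vanish for
  t <= s: the weighted bounds below contain this. *)
Fixpoint pb_term (k : nat) (t s : R) : 'M[R]_n :=
  match k with
  | 0%N => (powker a (t - s) / Gamma a)%:M
  | k'.+1 => mx_Rint (fun x => volterra_kernel t x *m pb_term k' x s)
  end.

Let measurable_powker2 : measurable_fun [set: R * R] (fun z => powker a (z.1 - z.2) /
    Gamma a).
Proof.
apply: measurable_funM => //; apply: (measurableT_comp (measurable_powker a)).
exact: measurable_funB.
Qed.

Lemma volterra_kernel_le t s i j : `|volterra_kernel t s i j| <= cA / Gamma a * powker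
    a (t - s).
Proof.
rewrite mxE normrM ger0_norm ?mulr_ge0 ?powker_ge0 ?invr_ge0 ?(ltW G0)//.
rewrite [leRHS](_ : _ = powker a (t - s) / Gamma a * cA); last by ring.
by rewrite ler_wpM2l// ?mulr_ge0 ?powker_ge0 ?invr_ge0 ?(ltW G0).
Qed.

Lemma measurable_volterra_kernel : mx_measurable (fun z : R * R => volterra_kernel z.1
    z.2).
Proof.
move=> i j; rewrite /volterra_kernel; under eq_fun do rewrite mxE.
apply: measurable_funM; first exact: measurable_powker2.
exact: measurableT_comp (mA i j) _.
Qed.

Lemma mx_measurable_section1 {m p} (L : R -> R -> 'M[R]_(m, p)) x :
  mx_measurable (fun z : R * R => L z.1 z.2) -> mx_measurable (L x).
Proof. by move=> mL i j; exact: (measurable_section1 x (mL i j)). Qed.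

Lemma mx_measurable_section2 {m p} (L : R -> R -> 'M[R]_(m, p)) y :
  mx_measurable (fun z : R * R => L z.1 z.2) -> mx_measurable (L ^~ y).
Proof. by move=> mL i j; exact: (measurable_section2 y (mL i j)). Qed.

Lemma measurable_mxI {d} {T : measurableType d} {m p} (f : T * R -> 'M[R]_(m, p)) :
  mx_measurable f -> mx_measurable (fun x => mx_Rint (fun y => f (x, y))).
Proof.
move=> mf i j; rewrite /mx_Rint; under eq_fun do rewrite mxE.
exact: (@measurable_Rintegral_param _ _ _ (fun z => f z i j)).
Qed.

Lemma mx_measurable_mulmx {d} {T : measurableType d} {m q p} (f : T -> 'M[R]_(m, q))
    (g : T -> 'M[R]_(q, p)) :
  mx_measurable f -> mx_measurable g -> mx_measurable (fun x => f x *m g x).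
Proof.
move=> mf mg i j; under eq_fun do rewrite mxE.
by apply: measurable_sum => k; exact: measurable_funM.
Qed.

Lemma measurable_pb_term k : mx_measurable (fun z : R * R => pb_term k z.1 z.2).
Proof.
elim: k => [|k IH] /=.
  move=> i j; rewrite (_ : (fun _ => _) =
      fun z => (powker a (z.1 - z.2) / Gamma a) * (i == j)%:R); last first.
    by apply/funext => z; rewrite mxE mulr_natr.
  exact: measurable_funM.
apply: (measurable_mxI (f := fun w : (R * R) * R => volterra_kernel w.1.1 w.2 *m
    pb_term k w.2 w.1.2)).
apply: mx_measurable_mulmx => i j.
- have m1 : measurable_fun [set: (R * R) * R] (fun w => (w.1.1, w.2)).
    by apply: measurable_fun_pair => //; exact: measurableT_comp.
  exact: (measurableT_comp (measurable_volterra_kernel i j) m1).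
- have m2 : measurable_fun [set: (R * R) * R] (fun w => (w.2, w.1.2)).
    by apply: measurable_fun_pair => //; exact: measurableT_comp.
  exact: (measurableT_comp (IH i j) m2).
Qed.

Let CM0 : 0 <= cA / Gamma a. Proof. by rewrite mulr_ge0 ?invr_ge0 ?(ltW G0). Qed.

(** The contraction estimate; everything about convergence follows from it. *)
Lemma volterra_kernel_halves {p} c s t (g : R -> 'M[R]_(n, p)) i j : 0 <= c ->
    mx_measurable g ->
  mx_bounded_by g (fun x => c * wpowker a l (x - s)) ->
  `|mx_Rint (fun x => volterra_kernel t x *m g x) i j| <= 2^-1 * c * wpowker a l (t - s).
Proof.
move=> c0 mg gle.
have H := @mx_Rint_dominated _ a l a01 l0 _ _ _ a (cA / Gamma a) c s t (volterra_kernel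
    t) g a01 CM0 c0
   (mx_measurable_section1 t measurable_volterra_kernel) mg (fun x i j _ =>
       volterra_kernel_le t x i j) gle
   _ i j (wpowker_conv_le s t a01 l0).
apply: (le_trans H).
rewrite [leLHS](_ : _ = n%:R * (cA / Gamma a * contraction_rate a l) * (c * wpowker a l
    (t - s))); last by ring.
by rewrite -[leRHS]mulrA ler_wpM2r// mulr_ge0// wpowker_ge0.
Qed.

Lemma pb_term_le k t s i j : `|pb_term k t s i j| <= (Gamma a)^-1 * 2^-1 ^+ k * wpowker
    a l (t - s).
Proof.
elim: k t i j => [|k IH] t i j.
  rewrite /= mxE expr0 mulr1; have H := powker_le_wpowker a l0 (t - s).
  have q0 : 0 <= powker a (t - s) / Gamma a by rewrite mulr_ge0 ?powker_ge0 ?invr_ge0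
      ?(ltW G0).
  apply: (@le_trans _ _ (powker a (t - s) / Gamma a)).
    by case: (i == j); rewrite ?mulr1n ?mulr0n ?normr0// ger0_norm.
  by rewrite mulrC ler_wpM2l ?invr_ge0 ?(ltW G0).
rewrite (_ : _ * 2^-1 ^+ k.+1 = 2^-1 * ((Gamma a)^-1 * 2^-1 ^+ k)); last first.
  by rewrite exprS mulrCA.
apply: (@volterra_kernel_halves _ ((Gamma a)^-1 * 2^-1 ^+ k)).
- by rewrite mulr_ge0 ?exprn_ge0 ?invr_ge0 ?(ltW G0).
- exact: (mx_measurable_section2 s (measurable_pb_term k)).
- by move=> x i' j'; exact: IH.
Qed.

Definition pb_resolvent (t s : R) : 'M[R]_n :=
  \matrix_(i, j) limn (series (fun k => pb_term k t s i j)).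

Let pb_tail t s i j :
  cvgn (series (fun k => pb_term k t s i j)) /\
  forall N, `|limn (series (fun k => pb_term k t s i j)) - series (fun k => pb_term k t
      s i j) N| <=
    2 * ((Gamma a)^-1 * wpowker a l (t - s)) * 2^-1 ^+ N.
Proof. by apply: geometric_tail => k; rewrite mulrAC; exact: pb_term_le. Qed.

Lemma pb_resolvent_cvg t s i j :
  series (fun k => pb_term k t s i j) @ \oo --> pb_resolvent t s i j.
Proof. by rewrite mxE; have [] := pb_tail t s i j. Qed.

Definition pb_psum N t s := \sum_(0 <= k < N) pb_term k t s.

Lemma pb_psumE N t s i j : pb_psum N t s i j = series (fun k => pb_term k t s i j) N.
Proof. by rewrite summxE. Qed.

Lemma pb_resolvent_tail N t s i j :
  `|(pb_resolvent t s - pb_psum N t s) i j| <= 2 / Gamma a * 2^-1 ^+ N * wpowker a l (t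
      - s).
Proof.
rewrite !mxE -[pb_psum _ _ _ _ _]/(pb_psum N t s i j) pb_psumE.
have [_ /(_ N)] := pb_tail t s i j.
by rewrite [X in _ -> _ <= X]mulrAC mulrA.
Qed.

Lemma pb_resolvent_le t s i j : `|pb_resolvent t s i j| <= 2 / Gamma a * wpowker a l (t
    - s).
Proof.
by have := pb_resolvent_tail 0 t s i j; rewrite /pb_psum big_geq// subr0 expr0 mulr1.
Qed.

Lemma measurable_pb_resolvent : mx_measurable (fun z : R * R => pb_resolvent z.1 z.2).
Proof.
move=> i j; apply: (@measurable_fun_cvg _ _ _ setT
    (fun N (z : R * R) => pb_psum N z.1 z.2 i j)) => //.
- move=> N; rewrite (_ : (fun _ => _) = (fun z : R * R => \sum_(0 <= k < N) pb_term k
    z.1 z.2 i j)).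
    by apply: measurable_sum => k; exact: measurable_pb_term.
  by apply/funext => z; rewrite summxE.
- move=> z _; have := @pb_resolvent_cvg z.1 z.2 i j.
  by under [X in _ -> X @ _ --> _]eq_fun do rewrite pb_psumE.
Qed.

Lemma measurable_pb_psum N : mx_measurable (fun z : R * R => pb_psum N z.1 z.2).
Proof.
move=> i j; rewrite (_ : (fun _ => _) = (fun z : R * R => \sum_(0 <= k < N) pb_term k
    z.1 z.2 i j)).
  by apply: measurable_sum => k; exact: measurable_pb_term.
by apply/funext => z; rewrite summxE.
Qed.

Lemma volterra_kernel_integrable {p} c s t (g : R -> 'M[R]_(n, p)) : 0 <= c ->
    mx_measurable g ->
  mx_bounded_by g (fun x => c * wpowker a l (x - s)) ->
  mx_integrableT (fun x => volterra_kernel t x *m g x).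
Proof.
move=> c0 mg gle.
exact: (@mx_integrable_dominated _ a l a01 l0 _ _ _ a (cA / Gamma a) c s t
    (volterra_kernel t) g a01 CM0 c0
   (mx_measurable_section1 t measurable_volterra_kernel) mg (fun x i j _ =>
       volterra_kernel_le t x i j) gle).
Qed.

Lemma pb_psumS N t s :
  pb_psum N.+1 t s = pb_term 0 t s + mx_Rint (fun x => volterra_kernel t x *m pb_psum N
      x s).
Proof.
elim: N => [|N IH].
  rewrite /pb_psum big_nat1 [X in _ + X](_ : _ = 0) ?addr0//.
  by rewrite -[RHS]mx_Rint0; apply: eq_mx_Rint => x; rewrite big_geq// mulmx0.
rewrite {1}/pb_psum big_nat_recr//= -/(pb_psum N.+1 t s) IH -addrA; congr (_ + _).
have C0 k : 0 <= (Gamma a)^-1 * 2^-1 ^+ k by rewrite mulr_ge0 ?exprn_ge0 ?invr_ge0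
    ?(ltW G0).
have ik k : mx_integrableT (fun x => volterra_kernel t x *m pb_term k x s).
  apply: (@volterra_kernel_integrable _ _ s _ _ (C0 k)).
    exact: (mx_measurable_section2 s (measurable_pb_term k)).
  by move=> x i j; exact: pb_term_le.
have iS : mx_integrableT (fun x => volterra_kernel t x *m pb_psum N x s).
  move=> i j; have [+ _] := @Rintegral_sum R _ (index_iota 0 N)
     (fun k x => (volterra_kernel t x *m pb_term k x s) i j) (fun k => ik k i j).
  by apply: eq_integrable => // x _; rewrite /= /pb_psum mulmx_sumr summxE.
rewrite -mx_RintD//; apply: eq_mx_Rint => x.
by rewrite -mulmxDr /pb_psum [in RHS]big_nat_recr.
Qed.

(** The difference of the two sides is the remainder of order N + 1 minus the
  operator applied to the remainder of order N, hence is O(2^(- N)). *)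
Lemma pb_resolvent_fixpoint t s : pb_resolvent t s = pb_term 0 t s + mx_Rint (fun x =>
    volterra_kernel t x *m pb_resolvent x s).
Proof.
apply/matrixP => i j; apply/eqP; rewrite -subr_eq0; apply/eqP.
apply: (@eq0_geometric _ _ (4 / Gamma a * wpowker a l (t - s))) => N.
pose C := 2 / Gamma a * 2^-1 ^+ N.
have C0 : 0 <= C by rewrite !mulr_ge0 ?exprn_ge0 ?invr_ge0 ?(ltW G0).
have mPhi := mx_measurable_section2 s measurable_pb_resolvent.
have mS := mx_measurable_section2 s (measurable_pb_psum N).
have iPhi : mx_integrableT (fun x => volterra_kernel t x *m pb_resolvent x s).
  apply: (@volterra_kernel_integrable _ (2 / Gamma a) s) => //.
    by rewrite mulr_ge0 ?invr_ge0 ?(ltW G0).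
  by move=> x i' j'; exact: pb_resolvent_le.
have mD : mx_measurable (fun x => pb_resolvent x s - pb_psum N x s).
  move=> i' j'; rewrite (_ : (fun _ => _) =
      (fun x => pb_resolvent x s i' j') \- (fun x => pb_psum N x s i' j')).
    exact: measurable_funB.
  by apply/funext => x /=; rewrite mxE [X in _ + X]mxE.
have iD : mx_integrableT (fun x => volterra_kernel t x *m (pb_resolvent x s - pb_psum N
    x s)).
  apply: (@volterra_kernel_integrable _ C s) => //.
  by move=> x i' j'; exact: pb_resolvent_tail.
have iS : mx_integrableT (fun x => volterra_kernel t x *m pb_psum N x s).
  move=> i' j'; have := integrableB measurableT (iPhi i' j') (iD i' j').
  apply: eq_integrable => // x _ /=.
  by rewrite mulmxBr -EFinB; congr EFin; rewrite !mxE; ring.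
have -> : pb_resolvent t s i j - (pb_term 0 t s + mx_Rint (fun x => volterra_kernel t x
    *m pb_resolvent x s)) i j =
  (pb_resolvent t s - pb_psum N.+1 t s) i j - mx_Rint (fun x => volterra_kernel t x *m
      (pb_resolvent x s - pb_psum N x s)) i j.
  have -> : mx_Rint (fun x => volterra_kernel t x *m (pb_resolvent x s - pb_psum N x s)) =
     mx_Rint (fun x => volterra_kernel t x *m pb_resolvent x s) - mx_Rint (fun x =>
         volterra_kernel t x *m pb_psum N x s).
    by rewrite -mx_RintB//; apply: eq_mx_Rint => x; rewrite mulmxBr.
  rewrite pb_psumS.
  set U := mx_Rint _; set V := mx_Rint _; set W := pb_resolvent t s; set Z := pb_term 0
      t s.
  by rewrite !mxE; ring.
rewrite (le_trans (ler_normB _ _))//.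
have B1 := pb_resolvent_tail N.+1 t s i j.
have B2 := @volterra_kernel_halves _ C s t (fun x => pb_resolvent x s - pb_psum N x s)
    i j C0 mD
   (fun x i j => pb_resolvent_tail N x s i j).
rewrite (le_trans (lerD B1 B2))// /C exprS.
have W0 := wpowker_ge0 a l (t - s).
have H0 : 0 <= (Gamma a)^-1 * 2^-1 ^+ N * wpowker a l (t - s).
  by apply: mulr_ge0 => //; rewrite mulr_ge0 ?exprn_ge0 ?invr_ge0 ?(ltW G0).
move: H0; set z := 2^-1 ^+ N => H0.
rewrite [leLHS](_ : _ = 2 * ((Gamma a)^-1 * z * wpowker a l (t - s))); last by field;
    rewrite gt_eqF.
rewrite [leRHS](_ : _ = 4 * ((Gamma a)^-1 * z * wpowker a l (t - s))); last by ring.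
by rewrite ler_wpM2r// ler_nat.
Qed.

End peano_baker.

(** * Variation of constants *)
Section variation_of_constants.
Context {R : realType} {n : nat}.
Notation mu := (@lebesgue_measure R).
Variables (a l cA : R) (A : R -> 'M[R]_n).
Hypotheses (a01 : 0 < a <= 1) (l0 : 0 < l) (cA0 : 0 <= cA).
Hypotheses (mA : mx_measurable A) (Ale : mx_bounded_by A (fun=> cA)).
Hypothesis small : n%:R * (cA / Gamma a * contraction_rate a l) <= 2^-1.
Variables (s cv : R) (x0 : 'cV[R]_n) (v : R -> 'cV[R]_n).
Hypotheses (cv0 : 0 <= cv) (mv : mx_measurable v).
Hypothesis vle : mx_bounded_by v (fun x => cv * wpowker a l (x - s)).

Notation Phi := (@pb_resolvent R n a A).
Notation Ker := (@volterra_kernel R n a A).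
Notation Trm := (@pb_term R n a A).

Let G0 : 0 < Gamma a. Proof. exact: Gamma_gt0. Qed.

Let Gi0 : 0 <= (Gamma a)^-1. Proof. by rewrite invr_ge0 ltW. Qed.

Let cP0 : 0 <= 2 / Gamma a. Proof. by rewrite mulr_ge0. Qed.

Let Phi_le := pb_resolvent_le a01 l0 cA0 mA Ale small.

Let measurable_Phi := measurable_pb_resolvent a01 l0 cA0 mA Ale small.

Lemma contraction_rate_ge0 : 0 <= contraction_rate a l.
Proof. by rewrite !mulr_ge0 ?powR_ge0 ?(ltW G0). Qed.

(** Bounding Phi(t, .) by the pure power costs e^(l (t - s)), which doubles
  the rate of the weight. *)
Lemma wpowker_double t : expR (l * `|t - s|) * wpowker a l (t - s) = wpowker a (2 * l)
    (t - s).
Proof.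
have [ts|st] := leP t s; first by rewrite !wpowker_npos ?subr_le0// mulr0.
rewrite gtr0_norm ?subr_gt0// /wpowker mulrCA -expRD.
by congr (_ * expR _); ring.
Qed.

Lemma wpowker_le_double t : wpowker a l (t - s) <= wpowker a (2 * l) (t - s).
Proof.
by rewrite -wpowker_double ler_peMl ?wpowker_ge0// -expR0 ler_expR mulr_ge0// ltW.
Qed.

Definition pb_conv t := mx_Rint (fun y => Phi t y *m v y).

(** The solution given by the theorem: homogeneous part plus response to the
  forcing term. *)
Definition pb_sol t := Phi t s *m x0 + pb_conv t.

Lemma measurable_pb_conv : mx_measurable pb_conv.
Proof.
apply: (measurable_mxI (f := fun z : R * R => Phi z.1 z.2 *m v z.2)).
apply: mx_measurable_mulmx; first exact: measurable_Phi.
by move=> i j; apply: (measurableT_comp (mv i j)).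
Qed.

Lemma measurable_pb_hom : mx_measurable (fun t => Phi t s *m x0).
Proof.
apply: mx_measurable_mulmx; last by move=> i j; exact: measurable_cst.
exact: (mx_measurable_section2 s measurable_Phi).
Qed.

Lemma measurable_pb_sol : mx_measurable pb_sol.
Proof.
move=> i j; rewrite (_ : (fun _ => _) = (fun t => (Phi t s *m x0) i j) \+
  (fun t => pb_conv t i j)); last by apply/funext => t; rewrite mxE.
by apply: measurable_funD; [exact: measurable_pb_hom|exact: measurable_pb_conv].
Qed.

Let Phi_le_pk t x i j : s < x ->
  `|Phi t x i j| <= 2 / Gamma a * expR (l * `|t - s|) * powker a (t - x).
Proof. by move=> sx; apply: mx_wpowker_le_powker sx => // *; exact: Phi_le. Qed.

Let cPe0 t : 0 <= 2 / Gamma a * expR (l * `|t - s|).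
Proof. by rewrite mulr_ge0 ?expR_ge0. Qed.

Lemma pb_conv_integrable t : mx_integrableT (fun y => Phi t y *m v y).
Proof.
exact: (@mx_integrable_dominated _ a l a01 l0 _ _ _ a _ cv s t (Phi t) v a01
   (cPe0 t) cv0 (mx_measurable_section1 t measurable_Phi) mv (Phi_le_pk t) vle).
Qed.

Definition conv_cst : R := n%:R * (2 / Gamma a * cv * contraction_rate a l).

Lemma pb_conv_le : mx_bounded_by pb_conv (fun t => conv_cst * wpowker a (2 * l) (t - s)).
Proof.
move=> t i j.
apply: (le_trans (@mx_Rint_dominated _ a l a01 l0 _ _ _ a _ cv s t (Phi t) v a01
   (cPe0 t) cv0 (mx_measurable_section1 t measurable_Phi) mv (Phi_le_pk t) vle
   _ i j (wpowker_conv_le s t a01 l0))).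
rewrite -wpowker_double /conv_cst; set e := expR _; set w := wpowker _ _ _.
by rewrite le_eqVlt; apply/orP; left; apply/eqP; ring.
Qed.

Definition hom_cst : R := 2 / Gamma a * \sum_k `|x0 k 0|.

Lemma pb_hom_le :
  mx_bounded_by (fun t => Phi t s *m x0) (fun t => hom_cst * wpowker a l (t - s)).
Proof.
move=> t i j; rewrite mxE (le_trans (ler_norm_sum _ _ _))//.
rewrite /hom_cst mulrAC mulr_sumr ler_sum// => k _.
by rewrite normrM (ord1 j) ler_wpM2r// Phi_le.
Qed.

Lemma hom_cst_ge0 : 0 <= hom_cst.
Proof. by rewrite mulr_ge0 ?sumr_ge0. Qed.

Lemma conv_cst_ge0 : 0 <= conv_cst.
Proof. by rewrite /conv_cst mulr_ge0// mulr_ge0 ?contraction_rate_ge0// mulr_ge0. Qed.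

Lemma pb_sol_le :
  mx_bounded_by pb_sol (fun t => (hom_cst + conv_cst) * wpowker a (2 * l) (t - s)).
Proof.
move=> t i j; rewrite [pb_sol t i j]mxE (le_trans (ler_normD _ _))// mulrDl.
rewrite lerD ?pb_conv_le// (le_trans (pb_hom_le _ _ _))//.
by rewrite ler_wpM2l ?wpowker_le_double// hom_cst_ge0.
Qed.

Let pb0_le t x i j : s < x -> `|Trm 0 t x i j| <= (Gamma a)^-1 * powker a (t - x).
Proof.
move=> _; rewrite mxE; have q0 : 0 <= powker a (t - x) / Gamma a by rewrite mulr_ge0
    ?powker_ge0.
apply: (@le_trans _ _ (powker a (t - x) / Gamma a)); last by rewrite mulrC.
by case: (i == j); rewrite ?mulr1n ?mulr0n ?normr0// ger0_norm.
Qed.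

Let l20 : 0 < 2 * l. Proof. by rewrite mulr_gt0. Qed.

(** The fixed point equation of the resolvent, integrated against v; the inner
  integral is moved outside by Fubini. *)
Lemma pb_conv_fixpoint t :
  pb_conv t = mx_Rint (fun y => Trm 0 t y *m v y) + mx_Rint (fun x => Ker t x *m
      pb_conv x).
Proof.
have i0 : mx_integrableT (fun y => Trm 0 t y *m v y).
  have H := (@mx_integrable_dominated _ a l a01 l0 _ _ _ a _ cv s t (Trm 0 t) v a01
   Gi0 cv0 (mx_measurable_section1 t (measurable_pb_term a mA 0)) mv (pb0_le t) vle).
  exact: H.
have decomp y : Phi t y *m v y =
    Trm 0 t y *m v y + mx_Rint (fun x => Ker t x *m Phi x y) *m v y.
  by rewrite {1}(pb_resolvent_fixpoint a01 l0 cA0 mA Ale small) mulmxDl.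
have i1 : mx_integrableT (fun y => mx_Rint (fun x => Ker t x *m Phi x y) *m v y).
  move=> i j; have := integrableB measurableT (pb_conv_integrable t i j) (i0 i j).
  apply: eq_integrable => // y _ /=.
  by rewrite decomp -EFinB mxE addrAC subrr add0r.
rewrite {1}/pb_conv (eq_mx_Rint decomp) mx_RintD//; congr (_ + _).
have cM0 : 0 <= cA / Gamma a by rewrite mulr_ge0.
by rewrite -(@mx_Fubini_dominated _ a l a01 l0 _ _ _ _ a (cA / Gamma a) (2 / Gamma a)
    cv s t
  (Ker t) Phi v a01 cM0 cP0 cv0 (mx_measurable_section1 t (measurable_volterra_kernel a
      mA))
  measurable_Phi mv (fun x i j _ => volterra_kernel_le a01 Ale t x i j) Phi_le vle).
Qed.

Lemma pb_hom_fixpoint t :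
  Phi t s *m x0 = Trm 0 t s *m x0 + mx_Rint (fun x => Ker t x *m (Phi x s *m x0)).
Proof.
rewrite {1}(pb_resolvent_fixpoint a01 l0 cA0 mA Ale small) mulmxDl; congr (_ + _).
rewrite -(mx_Rint_mulmxr _ _).2; first by apply: eq_mx_Rint => x; rewrite mulmxA.
apply: (volterra_kernel_integrable a01 l0 cA0 mA Ale t (s := s) cP0).
  exact: (mx_measurable_section2 s measurable_Phi).
by move=> x i j; exact: Phi_le.
Qed.

Definition pb_rhs y := v y + A y *m pb_sol y.

Definition rhs_cst : R := cv + n%:R * (cA * (hom_cst + conv_cst)).

Lemma rhs_cst_ge0 : 0 <= rhs_cst.
Proof.
by rewrite addr_ge0// mulr_ge0// mulr_ge0// addr_ge0 ?hom_cst_ge0 ?conv_cst_ge0.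
Qed.

Lemma measurable_pb_rhs : mx_measurable pb_rhs.
Proof.
move=> i j; rewrite (_ : (fun _ => _) = (fun t => v t i j) \+
  (fun t => (A t *m pb_sol t) i j)); last by apply/funext => t; rewrite mxE.
apply: measurable_funD; first exact: mv.
by apply: mx_measurable_mulmx; [exact: mA|exact: measurable_pb_sol].
Qed.

Lemma pb_rhs_le : mx_bounded_by pb_rhs (fun t => rhs_cst * wpowker a (2 * l) (t - s)).
Proof.
move=> t i j; rewrite [pb_rhs t i j]mxE (le_trans (ler_normD _ _))// /rhs_cst mulrDl.
have w0 := wpowker_ge0 a (2 * l) (t - s).
rewrite lerD//.
  by rewrite (le_trans (vle _ _ _))// ler_wpM2l// wpowker_le_double.
rewrite mxE (le_trans (ler_norm_sum _ _ _))//.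
apply: (@le_trans _ _ (\sum_(k < n) cA * (hom_cst + conv_cst) * wpowker a (2 * l) (t -
    s))).
  apply: ler_sum => k _; rewrite normrM.
  have := ler_pM (normr_ge0 _) (normr_ge0 _) (Ale t i k) (pb_sol_le t k j).
  by rewrite mulrA.
rewrite sumr_const card_ord -mulr_natl; set w := wpowker _ _ _.
by rewrite le_eqVlt; apply/orP; left; apply/eqP; ring.
Qed.

(** The Volterra equation x = (t - s)^(a - 1) / Gamma(a) x0 + J^a (v + A x), one
  entry at a time; from here on the argument is scalar. *)
Lemma pb_sol_volterra t i : pb_sol t i 0 = (Gamma a)^-1 *
  (powker a (t - s) * x0 i 0 + \int[mu]_y (powker a (t - y) * pb_rhs y i 0)).
Proof.
have ih : mx_integrableT (fun x => Ker t x *m (Phi x s *m x0)).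
  apply: (volterra_kernel_integrable a01 l0 cA0 mA Ale t (s := s) hom_cst_ge0).
    exact: measurable_pb_hom.
  exact: pb_hom_le.
have ic : mx_integrableT (fun x => Ker t x *m pb_conv x).
  apply: (volterra_kernel_integrable a01 l20 cA0 mA Ale t (s := s) conv_cst_ge0).
    exact: measurable_pb_conv.
  exact: pb_conv_le.
have isol : mx_integrableT (fun x => Ker t x *m pb_sol x).
  move=> i' j'; have := integrableD measurableT (ih i' j') (ic i' j').
  apply: eq_integrable => // x _ /=.
  by rewrite /pb_sol mulmxDr -EFinD; congr EFin; rewrite [RHS]mxE.
have i0 : mx_integrableT (fun y => Trm 0 t y *m v y).
  exact: (@mx_integrable_dominated _ a l a01 l0 _ _ _ a _ cv s t (Trm 0 t) v a01
   Gi0 cv0 (mx_measurable_section1 t (measurable_pb_term a mA 0)) mv (pb0_le t) vle).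
have -> : pb_sol t = Trm 0 t s *m x0 + mx_Rint (fun y => Trm 0 t y *m v y + Ker t y *m
    pb_sol y).
  rewrite /pb_sol pb_conv_fixpoint pb_hom_fixpoint mx_RintD// -addrA; congr (_ + _).
  rewrite addrCA; congr (_ + _).
  by rewrite -mx_RintD//; apply: eq_mx_Rint => y; rewrite -mulmxDr.
rewrite mxE mulrDr; congr (_ + _).
  by rewrite /= mul_scalar_mx mxE mulrA [X in X * _]mulrC.
rewrite mxE -RintegralZl//.
  apply: eq_Rintegral => y _.
  rewrite /= mul_scalar_mx /volterra_kernel -scalemxAl -scalerDr mxE mulrA.
  by rewrite [X in X * _]mulrC.
apply: (@integrable_dominated _ a (2 * l) a01 l20 a 1 rhs_cst s t) => //.
- exact: rhs_cst_ge0.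
- by apply: (measurableT_comp (measurable_powker a)); exact: measurable_funB.
- exact: measurable_pb_rhs.
- by move=> x _; rewrite ger0_norm ?powker_ge0// mul1r.
- by move=> x; exact: pb_rhs_le.
Qed.

End variation_of_constants.

(** * Abel integrals: inversion, continuity, differentiation *)
Section scalar_volterra.
Context {R : realType}.
Notation mu := (@lebesgue_measure R).
Variables (a l c s : R) (g : R -> R).
Hypotheses (a01 : 0 < a < 1) (l0 : 0 < l) (c0 : 0 <= c).
Hypothesis mg : measurable_fun [set: R] g.
Hypothesis gle : forall y, `|g y| <= c * wpowker a l (y - s).

Let a0 : 0 < a. Proof. by case/andP: a01. Qed.

Let a01W : 0 < a <= 1. Proof. by case/andP: a01 => -> /ltW. Qed.

Let b01W : 0 < 1 - a <= 1.
Proof. by case/andP: a01 => _ a1; rewrite subr_gt0 a1 gerBl ltW. Qed.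

(** On x < h the indicator is at most e e^(- x / h), which reduces the mass
  of the singularity to the Laplace transform with rate 1 / h. *)
Lemma integral_powker_near0 (f : R -> R) h : 0 < h -> measurable_fun [set: R] f ->
  (forall x, `|f x| <= if x < h then powker a x else 0) ->
  mu.-integrable [set: R] (EFin \o f) /\
  (\int[mu]_x `|(f x)%:E| <= (expR 1 * (h `^ a * Gamma a))%:E)%E.
Proof.
move=> h0 mf fle.
have hi : 0 < h^-1 by rewrite invr_gt0.
have bnd : (\int[mu]_x `|(f x)%:E| <= (expR 1 * (h `^ a * Gamma a))%:E)%E.
  have -> : h `^ a = h^-1 `^ (- a).
    by rewrite -powR_inv1 ?ltW// -powRrM mulN1r opprK.
  rewrite (EFinM (expR 1)) -laplace_powker// -ge0_integralZl//; first last.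
  - by move=> x _; rewrite lee_fin mulr_ge0 ?powker_ge0 ?expR_ge0.
  - by apply/measurable_EFinP; exact: measurable_powker_exp.
  apply: ge0_le_integral => //.
  - by apply: measurableT_comp => //; exact/measurable_EFinP.
  - apply/measurable_EFinP; apply: (measurable_funM (f := cst (expR 1))) => //.
    exact: measurable_powker_exp.
  - move=> x _; rewrite abse_EFin -EFinM lee_fin (le_trans (fle x))//.
    case: (ltP x h) => xh; last by rewrite !mulr_ge0 ?powker_ge0 ?expR_ge0.
    rewrite mulrCA -expRD ler_peMr ?powker_ge0// -[leLHS]expR0 ler_expR subr_ge0.
    by rewrite mulrC ler_pdivrMr// mul1r ltW.
split=> //; apply/integrableP; split; first exact/measurable_EFinP.
by apply: (le_lt_trans bnd); exact: ltry.
Qed.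

(** The primitive of g from s, since g vanishes up to s. *)
Definition primitive (t : R) : R := \int[mu]_y ((y < t)%R%:R * g y).

Let measurable_cut t : measurable_fun [set: R] (fun y => (y < t)%R%:R * g y).
Proof.
apply: measurable_funM => //.
rewrite (_ : (fun _ => _) = \1_(`]-oo, t[)%classic); first exact: measurable_indic.
by apply/funext => y; rewrite indicE; congr (_%:R); rewrite mem_setE in_itv.
Qed.

Let measurable_powker_cut h : measurable_fun [set: R]
  (fun y => if y - s < h then powker a (y - s) else 0).
Proof.
apply: measurable_fun_ifT => //.
- by apply: measurable_fun_ltr => //; exact: measurable_funB.
- by apply: (measurableT_comp (measurable_powker a)); exact: measurable_funB.
Qed.

Lemma primitive_le t : s < t ->
  mu.-integrable [set: R] (EFin \o (fun y => (y < t)%R%:R * g y)) /\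
  `|primitive t| <= c * expR (l * (t - s)) * (expR 1 * ((t - s) `^ a * Gamma a)).
Proof.
move=> st; have h0 : 0 < t - s by rewrite subr_gt0.
pose e := c * expR (l * (t - s)).
have e0 : 0 <= e by rewrite mulr_ge0 ?expR_ge0.
pose k x := if x < t - s then powker a x else 0.
have k0 x : 0 <= k x by rewrite /k; case: ifP; rewrite ?powker_ge0.
have mk : measurable_fun [set: R] k.
  by apply: measurable_fun_ifT => //; [exact: measurable_fun_ltr|exact:
      measurable_powker].
have [ik bk] := integral_powker_near0 h0 mk (fun x => ltac:(by rewrite ger0_norm)).
have gk y : `|(y < t)%R%:R * g y| <= e * k (y - s).
  rewrite /k ltrD2r; case: ltP => yt; last by rewrite mul0r normr0 mulr0.
  rewrite mul1r (le_trans (gle y))// /e -mulrA ler_wpM2l//.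
  have [ys|sy] := leP y s; first by rewrite wpowker_npos ?subr_le0// mulr_ge0 ?expR_ge0
      ?powker_ge0.
  rewrite /wpowker mulrC ler_wpM2r ?powker_ge0// ler_expR ler_wpM2l ?(ltW l0)//.
  by rewrite lerD2r ltW.
have B : (\int[mu]_y `|((y < t)%R%:R * g y)%:E| <=
    (e * (expR 1 * ((t - s) `^ a * Gamma a)))%:E)%E.
  apply: (@le_trans _ _ (\int[mu]_y (e%:E * (k (y - s))%:E))%E).
    apply: ge0_le_integral => //.
    - apply: measurableT_comp => //; apply/measurable_EFinP; exact: measurable_cut.
    - apply/measurable_EFinP; apply: (measurable_funM (f := cst e)) => //.
      exact: measurable_powker_cut.
    - by move=> y _; rewrite abse_EFin -EFinM lee_fin.
  rewrite ge0_integralZl//; first last.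
  - by move=> y _; rewrite lee_fin.
  - by apply/measurable_EFinP; exact: measurable_powker_cut.
  rewrite (EFinM e) lee_wpmul2l ?lee_fin//.
  apply: le_trans bk; rewrite [leRHS](@ge0_integral_affine _ 1 (- s))//.
  - rewrite normr1 mul1e le_eqVlt; apply/orP; left; apply/eqP.
    by apply: eq_integral => y _; rewrite mul1r abse_EFin ger0_norm.
  - by apply: measurableT_comp => //; exact/measurable_EFinP.
have i : mu.-integrable [set: R] (EFin \o (fun y => (y < t)%R%:R * g y)).
  apply/integrableP; split; first by apply/measurable_EFinP; exact: measurable_cut.
  by apply: (le_lt_trans B); exact: ltry.
split=> //; rewrite -lee_fin EFin_normr_Rintegral//.
apply: le_trans B; apply: le_abse_integral => //; apply/measurable_EFinP.
exact: measurable_cut.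
Qed.

Lemma primitive_cvg0 : primitive t @[t --> s^'+] --> 0.
Proof.
pose B t := c * expR (l * (t - s)) * (expR 1 * ((t - s) `^ a * Gamma a)).
have B0 : B t @[t --> s^'+] --> 0.
  have -> : 0 = c * expR (l * (s - s)) * (expR 1 * (0 * Gamma a)) by rewrite mul0r !mulr0.
  apply: cvgM.
    apply: cvgMr; apply: (cvg_comp _ expR); last exact: continuous_expR.
    apply: cvgMr; apply: cvgB; last exact: cvg_cst.
    exact: cvg_at_right_filter.
  apply: cvgMr; apply: cvgMl.
  apply: (cvg_comp (fun t => t - s) (fun r => r `^ a)); last exact: (powR_cvg0 a0).
  move=> P [e /= e0 eP]; exists e => //= t ts st; apply: eP => /=.
    by rewrite sub0r normrN -normrN opprB.
  by rewrite subr_gt0.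
apply: (squeeze_cvgr (f := fun t => - B t) (h := B)) => //; last first.
  by rewrite -oppr0; exact: cvgN.
near=> t; rewrite -ler_norml.
have st : s < t by [].
by have [] := primitive_le st.
Unshelve. all: by end_near. Qed.

(** A bounded continuous kernel that agrees with [powker a] outside ]0, d[ and
  lies below it: the power is frozen below d and multiplied by a linear ramp. *)
Definition soft_kernel (d r : R) : R :=
  Num.max r d `^ (a - 1) * Num.min 1 (Num.max 0 (r / d)).

Lemma soft_kernel_ge0 d r : 0 <= soft_kernel d r.
Proof. by rewrite mulr_ge0 ?powR_ge0// le_min ler01 le_max lexx. Qed.

Lemma soft_kernel_npos d r : 0 < d -> r <= 0 -> soft_kernel d r = 0.
Proof.
move=> d0 r0; rewrite /soft_kernel (max_l (_ : r / d <= 0)).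
  by rewrite min_r// mulr0.
by rewrite mulr_le0_ge0// invr_ge0 ltW.
Qed.

Lemma soft_kernel_far d r : 0 < d -> d <= r -> soft_kernel d r = powker a r.
Proof.
move=> d0 dr; have r0 := lt_le_trans d0 dr.
rewrite /soft_kernel (max_l dr) powker_pos// min_l ?mulr1//.
by rewrite le_max ler_pdivlMr// mul1r dr orbT.
Qed.

Lemma soft_kernel_le d r : 0 < d -> soft_kernel d r <= d `^ (a - 1).
Proof.
move=> d0; rewrite /soft_kernel -[leRHS]mulr1 ler_pM ?powR_ge0//.
- by rewrite le_min ler01 le_max lexx.
- by apply: powR_npow_le => //; [rewrite subr_le0; case/andP: a01W|rewrite le_max lexx
    orbT].
- by rewrite ge_min lexx.
Qed.

Lemma soft_kernel_le_powker d r : 0 < d -> soft_kernel d r <= powker a r.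
Proof.
move=> d0; have [r0|r0] := leP r 0; first by rewrite soft_kernel_npos ?powker_ge0.
rewrite powker_pos// /soft_kernel -[leRHS]mulr1 ler_pM ?powR_ge0//.
- by rewrite le_min ler01 le_max lexx.
- by apply: powR_npow_le => //; [rewrite subr_le0; case/andP: a01W|rewrite le_max lexx].
- by rewrite ge_min lexx.
Qed.

Lemma soft_kernel_continuous d : 0 < d -> continuous (soft_kernel d).
Proof.
move=> d0 r; apply: cvgM.
  have m0 : 0 < Num.max r d by rewrite lt_max d0 orbT.
  apply: (continuous_comp (f := fun r => Num.max r d) (g := fun r => r `^ (a - 1))).
    by apply: continuous_max => //; exact: cvg_cst.
  apply/differentiable_continuous/derivable1_diffP.
  by apply: derivable_powR; rewrite in_itv/= m0.
have c1 (u : R) : {for r, continuous (fun _ : R => u)} by exact: cvg_cst.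
apply: (continuous_min (c1 1)); apply: (continuous_max (c1 0)).
by apply: cvgMl.
Qed.

Lemma measurable_soft_kernel d : 0 < d -> measurable_fun [set: R] (soft_kernel d).
Proof. by move=> d0; apply: continuous_measurable_fun; exact: soft_kernel_continuous. Qed.

(** Gamma(a) times the fractional integral of order a of g. *)
Definition abel_int t := \int[mu]_y (powker a (t - y) * g y).

Definition soft_abel_int d t := \int[mu]_y (soft_kernel d (t - y) * g y).

Let integrable_abel_int t : mu.-integrable [set: R] (EFin \o (fun y => powker a (t - y)
    * g y)).
Proof.
apply: (@integrable_dominated _ a l a01W l0 a 1 c s t) => //.
- by apply: (measurableT_comp (measurable_powker a)); exact: measurable_funB.
- by move=> y _; rewrite ger0_norm ?powker_ge0// mul1r.
Qed.

Let measurable_soft_abel_int d t : 0 < d ->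
  measurable_fun [set: R] (fun y => soft_kernel d (t - y) * g y).
Proof.
move=> d0; apply: measurable_funM => //.
by apply: (measurableT_comp (measurable_soft_kernel d0)); exact: measurable_funB.
Qed.

Let integrable_soft_abel_int d t : 0 < d ->
  mu.-integrable [set: R] (EFin \o (fun y => soft_kernel d (t - y) * g y)).
Proof.
move=> d0; apply: le_integrable (integrable_abel_int t) => //.
  by apply/measurable_EFinP; exact: measurable_soft_abel_int.
move=> y _; rewrite !abse_EFin lee_fin (normrM (soft_kernel _ _)) (normrM (powker _ _)).
rewrite ler_wpM2r//.
by rewrite !ger0_norm ?soft_kernel_ge0 ?powker_ge0// soft_kernel_le_powker.
Qed.

(** For the softened kernel the integrand is continuous in t for every y, and on
  ]s, t + 1[ it is dominated by a multiple of |g|. *)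
Lemma soft_abel_int_continuous d t : 0 < d -> s < t -> {for t, continuous
    (soft_abel_int d)}.
Proof.
move=> d0 st.
have sT : s < t + 1 by rewrite (lt_trans st)// ltrDl.
have [ig _] := primitive_le sT.
have := @continuity_under_integral R _ _ mu (fun r y => soft_kernel d (r - y) * g y)
  setT measurableT s (t + 1).
have H1 : forall x, `]s, t + 1[%classic x ->
   mu.-integrable setT (EFin \o (fun y => soft_kernel d (x - y) * g y)).
  by move=> x _; exact: integrable_soft_abel_int.
have H2 : {ae mu, forall y, [set: R] y ->
   {in `]s, t + 1[%classic, continuous ((fun r y => soft_kernel d (r - y) * g y) ^~ y)}}.
  apply: aeW => y _ r _; apply: cvgMl.
  apply: (continuous_comp (f := fun r => r - y) (g := soft_kernel d)).
    by apply: cvgB => //; exact: cvg_cst.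
  exact: soft_kernel_continuous.
move=> /(_ H1 H2 (fun y => d `^ (a - 1) * `|(y < t + 1)%R%:R * g y|)).
apply.
- have := integrableZl measurableT (d `^ (a - 1)) (integrable_abse ig).
  by apply: eq_integrable => // y _; rewrite /= EFinM.
- move=> r /=; rewrite in_itv/= => /andP[sr rt]; apply: aeW => y _.
  have [ty|yt] := leP (t + 1) y.
    by rewrite soft_kernel_npos ?mul0r ?normr0 ?mulr0// subr_le0 (le_trans (ltW rt)).
  rewrite mul1r normrM ler_wpM2r// ger0_norm ?soft_kernel_ge0//.
  exact: soft_kernel_le.
- by apply/mem_set; rewrite /= in_itv/= st ltrDl ltr01.
Qed.

(** The two kernels differ only on t - d < y < t. There g is bounded, because y
  stays to the right of m > s, and the kernel has mass O(d^a). *)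
Lemma soft_abel_int_close d m T t : 0 < d -> s < m -> m < t - d -> t < T ->
  `|abel_int t - soft_abel_int d t| <=
  c * ((m - s) `^ (a - 1) * expR (l * (T - s))) * (expR 1 * (d `^ a * Gamma a)).
Proof.
move=> d0 sm mt tT; set D := c * _.
have D0 : 0 <= D by rewrite !mulr_ge0 ?powR_ge0 ?expR_ge0.
pose k r := if r < d then powker a r else 0.
have k0 r : 0 <= k r by rewrite /k; case: ifP; rewrite ?powker_ge0.
have mk : measurable_fun [set: R] k.
  by apply: measurable_fun_ifT => //; [exact: measurable_fun_ltr|exact:
      measurable_powker].
have [ik bk] := integral_powker_near0 d0 mk (fun x => ltac:(by rewrite ger0_norm)).
have gD y : m < y -> y < t -> `|g y| <= D.
  move=> my yt; rewrite (le_trans (gle y))// /D ler_wpM2l//.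
  have sy := lt_trans sm my.
  rewrite /wpowker powker_pos ?subr_gt0// ler_pM ?powR_ge0 ?expR_ge0//.
    apply: powR_npow_le; rewrite ?subr_gt0 ?lerD2r ?subr_le0 ?(ltW my)//.
    by case/andP: a01W.
  by rewrite ler_expR ler_wpM2l ?(ltW l0)// lerD2r ltW// (lt_trans yt).
have diffE y : `|powker a (t - y) * g y - soft_kernel d (t - y) * g y| <= D * k (t - y).
  rewrite -mulrBl normrM /k; case: ltP => tyd; last first.
    by rewrite soft_kernel_far// subrr normr0 mul0r mulr0.
  have [ty|yt] := leP t y.
    by rewrite soft_kernel_npos ?powker_npos ?subr_le0// subrr normr0 mul0r mulr0.
  rewrite mulrC ler_pM//; first by apply: gD => //; lra.
  rewrite ger0_norm ?subr_ge0 ?soft_kernel_le_powker//.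
  by rewrite gerBl soft_kernel_ge0.
have idiff := integrableB measurableT (integrable_abel_int t) (integrable_soft_abel_int
    t d0).
rewrite /abel_int /soft_abel_int -RintegralB//; last exact: integrable_soft_abel_int.
have iB : mu.-integrable [set: R]
   (EFin \o (fun y => powker a (t - y) * g y - soft_kernel d (t - y) * g y)).
  by apply: eq_integrable idiff.
have mkt : measurable_fun [set: R] (fun y => k (t - y)).
  by apply: (measurableT_comp mk); exact: measurable_funB.
rewrite -lee_fin EFin_normr_Rintegral//.
apply: le_trans (le_abse_integral _ _ _) _ => //.
  exact: measurable_int iB.
apply: (@le_trans _ _ (\int[mu]_y (D%:E * (k (t - y))%:E))%E).
  apply: ge0_le_integral => //.
  - by apply: measurableT_comp => //; exact: measurable_int iB.
  - by apply/measurable_EFinP; apply: (measurable_funM (f := cst D)).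
  - by move=> y _; rewrite /= lee_fin.
rewrite ge0_integralZl//; first last.
- by move=> y _; rewrite lee_fin.
- exact/measurable_EFinP.
rewrite (EFinM D) lee_wpmul2l ?lee_fin//.
apply: le_trans bk; rewrite [leRHS](@ge0_integral_affine _ (-1) t)//.
- rewrite normrN1 mul1e le_eqVlt; apply/orP; left; apply/eqP.
  by apply: eq_integral => y _; rewrite mulN1r abse_EFin ger0_norm// addrC.
- by apply: measurableT_comp => //; exact/measurable_EFinP.
Qed.

(** A locally uniform limit, as d tends to 0, of continuous functions. *)
Lemma abel_int_continuous t : s < t -> {for t, continuous abel_int}.
Proof.
move=> st; pose m := (s + t) / 2; pose T := t + 1.
have sm : s < m by rewrite /m; lra.
have mt : m < t by rewrite /m; lra.
pose D := c * ((m - s) `^ (a - 1) * expR (l * (T - s))) * (expR 1 * Gamma a).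
have D0 : 0 <= D.
  by rewrite !mulr_ge0 ?powR_ge0 ?expR_ge0// ltW// Gamma_gt0.
apply/cvgrPdist_le => /= e e0.
have [d /andP[d0 dm] De] : exists2 d, 0 < d < (t - m) / 2 & D * d `^ a <= e / 3.
  have D1 : 0 < D + 1 by rewrite ltr_pwDr.
  (* h solves (D + 1) h^a = e / 3; the quarter keeps t - d above m with some room *)
  pose h := (e / 3 / (D + 1)) `^ a^-1.
  have e3 : 0 < e / 3 / (D + 1) by rewrite !divr_gt0.
  have h0 : 0 < h by rewrite powR_gt0.
  exists (Num.min h ((t - m) / 4)).
    by rewrite lt_min h0/= gt_min; apply/andP; split; [lra|apply/orP; right; lra].
  apply: (@le_trans _ _ ((D + 1) * h `^ a)).
    rewrite ler_pM ?powR_ge0 ?lerDl// ge0_ler_powR ?(ltW a0) ?nnegrE ?(ltW h0)//.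
      by rewrite le_min (ltW h0)/=; lra.
    by rewrite ge_min lexx.
  by rewrite /h -powRrM mulVf ?gt_eqF// powRr1 ?(ltW e3)// mulrC divfK ?gt_eqF.
have e3 : 0 < e / 3 by rewrite divr_gt0.
have close r : m < r - d -> r < T -> `|abel_int r - soft_abel_int d r| <= e / 3.
  move=> mr rT; apply: (le_trans (soft_abel_int_close d0 sm mr rT)).
  apply: le_trans De; rewrite le_eqVlt; apply/orP; left; apply/eqP.
  by rewrite /D; ring.
have := soft_abel_int_continuous d0 st; move/cvgrPdist_le => /(_ _ e3) sc.
have ct : `|abel_int t - soft_abel_int d t| <= e / 3.
  by apply: close; rewrite ?ltrDl//; lra.
near=> r.
have cr : `|abel_int r - soft_abel_int d r| <= e / 3.
  apply: close.
    have : t - d < r by near: r; apply: lt_nbhsr; rewrite ltrBlDr ltrDl.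
    lra.
  by near: r; apply: lt_nbhsl; rewrite ltrDl.
have sr : `|soft_abel_int d t - soft_abel_int d r| <= e / 3 by near: r.
rewrite (_ : abel_int t - abel_int r = (abel_int t - soft_abel_int d t) +
    (soft_abel_int d t - soft_abel_int d r)
  - (abel_int r - soft_abel_int d r)); last by ring.
rewrite (le_trans (ler_normB _ _))// (le_trans (lerD (ler_normD _ _) (lexx _)))//.
by rewrite (le_trans (lerD (lerD ct sr) cr))//; lra.
Unshelve. all: by end_near. Qed.

Lemma primitive_derivative t : s < t -> {for t, continuous g} ->
  (r - t)^-1 * (primitive r - primitive t) @[r --> t^'] --> g t.
Proof.
move=> st gt.
have igr r : mu.-integrable `]-oo, r] (EFin \o g).
  have sr : s < Num.max s r + 1 by rewrite ltr_pwDr// le_max lexx.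
  have [+ _] := primitive_le sr; move/(integrableS measurableT) => H.
  have := H `]-oo, r]%classic (measurable_itv _) (subsetT _).
  apply: eq_integrable => // y /set_mem/=; rewrite in_itv/= => yr.
  by rewrite (_ : y < _) ?mul1r// ltr_pwDr// le_max yr orbT.
have primE r : primitive r = \int[mu]_(y in `]-oo, r]) g y.
  rewrite -Rintegral_itv_bndo_bndc; last first.
    by apply: integrableS (igr r) => //; apply: subset_itvl; rewrite bnd_simp.
  rewrite Rintegral_mkcond; apply: eq_Rintegral => y _.
  by rewrite patchE mem_setE in_itv/=; case: (ltP y r) => _; rewrite ?mul1r ?mul0r.
have tu : t < t + 1 by rewrite ltrDl.
have [] := @continuous_FTC1 R g -oo%O t (t + 1) tu (igr _) _ gt; first by rewrite ltNyr.
set F := (fun y => _) => dF dFE.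
have cvF : (fun h => h^-1 *: ((F \o shift t) (h *: 1) - F t)) @ 0^' --> g t.
  by rewrite -dFE derive1E; exact: dF.
have sh : (fun r => r - t) @ t^' --> 0^'.
  move=> P [e /= e0 eP]; exists e => //= r tr rt; apply: eP => /=.
    by rewrite sub0r normrN distrC.
  by rewrite subr_eq0.
have := cvg_comp _ _ sh cvF; apply: cvg_trans.
rewrite (_ : _ \o _ = fun r => (r - t)^-1 * (primitive r - primitive t))//.
apply/funext => r /=; rewrite /GRing.scale/= mulr1 subrK.
by rewrite !primE.
Qed.

Section solution.
Variable x0 : R.

Definition abel_sol (t : R) : R := (Gamma a)^-1 * (powker a (t - s) * x0 + \int[mu]_y
    (powker a (t - y) * g y)).

(** The heart of the passage from the integral equation to the fractional
  differential equation: J^(1 - a) J^a is the ordinary integral, and J^(1 - a)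
  sends (t - s)^(a - 1) / Gamma(a) to the constant 1. *)
Lemma abel_sol_RL t : s < t ->
  \int[mu]_y (powker (1 - a) (t - y) * abel_sol y) = Gamma (1 - a) * (x0 + primitive t).
Proof.
move=> st.
have mpk b u : measurable_fun [set: R] (fun y => powker b (u - y)).
  by apply: (measurableT_comp (measurable_powker b)); exact: measurable_funB.
have mpkr b u : measurable_fun [set: R] (fun y => powker b (y - u)).
  by apply: (measurableT_comp (measurable_powker b)); exact: measurable_funB.
have beta u : \int[mu]_x (powker (1 - a) (t - x) * powker a (x - u)) =
    Gamma (1 - a) * Gamma a * (u < t)%R%:R.
  rewrite /Rintegral; case: ltP => [ut|tu]; first by rewrite powker_conv_beta// mulr1.
  rewrite mulr0 integral0_eq// => x _.
  have [xu|ux] := leP x u; first by rewrite (powker_npos a) ?mulr0// subr_le0.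
  by rewrite (powker_npos (1 - a)) ?mul0r// subr_le0 (le_trans tu)// ltW.
have [i2 i3 FE] := @Fubini_dominated _ a l a01W l0 (1 - a) 1 1 c s t (fun y => powker
    (1 - a) (t - y))
  (fun z => powker a (z.1 - z.2)) g b01W ler01 ler01 c0 (mpk _ _)
  (measurableT_comp (measurable_powker a) (measurable_funB measurable_fst measurable_snd))
  mg (fun y _ => ltac:(by rewrite ger0_norm ?powker_ge0// mul1r))
  (fun x y _ => ltac:(by rewrite ger0_norm ?powker_ge0// mul1r /= powker_le_wpowker)) gle.
have i1 : mu.-integrable [set: R] (EFin \o (fun y => powker (1 - a) (t - y) * powker a
    (y - s))).
  apply: (@integrable_dominated _ a l a01W l0 (1 - a) 1 1 s t) => //.
  - by move=> y _; rewrite ger0_norm ?powker_ge0// mul1r.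
  - by move=> y; rewrite ger0_norm ?powker_ge0// mul1r powker_le_wpowker.
have G0 : Gamma a != 0 by rewrite gt_eqF// Gamma_gt0.
transitivity (\int[mu]_y ((Gamma a)^-1 * ((powker (1 - a) (t - y) * powker a (y - s)) *
    x0 +
   powker (1 - a) (t - y) * \int[mu]_z (powker a (y - z) * g z)))).
  apply: eq_Rintegral => y _; rewrite /abel_sol.
  by set u := \int[mu]_z _; set p := powker _ _; set q := powker _ _; ring.
have i1' : mu.-integrable [set: R] (EFin \o (fun y => (powker (1 - a) (t - y) * powker
    a (y - s)) * x0)).
  have := integrableZr measurableT x0 i1.
  by apply: eq_integrable => // y _; rewrite /= -EFinM.
have i12 : mu.-integrable [set: R] (EFin \o (fun y => (powker (1 - a) (t - y) * powker
    a (y - s)) * x0 +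
   powker (1 - a) (t - y) * \int[mu]_z (powker a (y - z) * g z))).
  have := integrableD measurableT i1' i2.
  by apply: eq_integrable => // y _; rewrite /= -EFinD.
rewrite RintegralZl// RintegralD// RintegralZr// beta st mulr1 FE/=.
under eq_Rintegral do rewrite beta -(mulrA (Gamma (1 - a) * Gamma a)).
rewrite RintegralZl//; last by have [] := primitive_le st.
by rewrite -/(primitive t); field.
Qed.

End solution.

End scalar_volterra.

(** * Entrywise convergence of matrices *)
Section entrywise_convergence.
Context {R : realType}.

Lemma cvg_mx {T : Type} {F : set_system T} {FF : Filter F} {m p}
    (f : T -> 'M[R]_(m, p)) (M : 'M[R]_(m, p)) :
  (forall i j, (fun x => f x i j) @ F --> M i j) -> f @ F --> M.
Proof.
move=> fM A [P MP PA].
have : \forall x \near F, forall i j, P i j (f x i j).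
  apply: filter_forall => i; apply: filter_forall => j.
  exact: fM (MP i j).
by apply: filterS => x /PA.
Qed.

Lemma cvg_mx_entry {T : Type} {F : set_system T} {FF : Filter F} {m p}
    (f : T -> 'M[R]_(m, p)) (M : 'M[R]_(m, p)) i j :
  f @ F --> M -> (fun x => f x i j) @ F --> M i j.
Proof. by move=> fM; exact: (cvg_comp _ _ fM (@coord_continuous _ _ _ i j M)). Qed.

Lemma cvg_sum_seq {T : Type} {F : set_system T} {FF : Filter F} {J : Type}
    (r : seq J) (f : J -> T -> R) (L : J -> R) :
  (forall k, f k @ F --> L k) ->
  (fun x => \sum_(k <- r) f k x) @ F --> \sum_(k <- r) L k.
Proof.
move=> fL; elim: r => [|k r IH].
  by rewrite big_nil; under eq_fun do rewrite big_nil; exact: cvg_cst.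
by rewrite big_cons; under eq_fun do rewrite big_cons; exact: cvgD.
Qed.

Lemma finite_bound {I : finType} {T : Type} (f : I -> T -> R) :
  (forall k, exists M, forall x, `|f k x| <= M) ->
  exists2 M, 0 <= M & forall k x, `|f k x| <= M.
Proof.
move=> /choice[M fM]; exists (\sum_k `|M k|); first by rewrite sumr_ge0.
move=> k x; rewrite (le_trans (fM k x))// (le_trans (ler_norm _))//.
by rewrite (bigD1 k)//= lerDl sumr_ge0.
Qed.

End entrywise_convergence.

(** * Coefficients on a compact interval *)
Section clamp.
Context {R : realType}.
Variables (I : interval R) (t0 T : R).
Hypotheses (It0 : t0 \in I) (IT : T \in I) (t0T : t0 <= T).

(** The projection of the line onto [t0, T]. *)
Definition clamp (y : R) : R := Num.max t0 (Num.min T y).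

Lemma clamp_itv y : t0 <= clamp y <= T.
Proof. by rewrite le_max lexx/= ge_max t0T ge_min lexx. Qed.

Lemma clamp_id y : t0 <= y <= T -> clamp y = y.
Proof. by move=> /andP[ty yT]; rewrite /clamp (min_r yT) (max_r ty). Qed.

Lemma clamp_in y : clamp y \in I.
Proof.
by have := @interval_is_interval R I t0 T It0 IT (clamp y) (clamp_itv y).
Qed.

Lemma clamp_continuous : continuous clamp.
Proof.
move=> y; have c1 (u : R) : {for y, continuous (fun _ : R => u)} by exact: cvg_cst.
by apply: (continuous_max (c1 t0)); apply: (continuous_min (c1 T)).
Qed.

Lemma comp_clamp_continuous {m p} (f : R -> 'M[R]_(m, p)) :
  {within [set` I], continuous f} ->
  forall i j, continuous (fun y => f (clamp y) i j).
Proof.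
move=> /subspace_continuousP cf i j y.
apply: cvg_mx_entry; have := cf (clamp y) (clamp_in y).
apply: cvg_trans => P cP.
have cP' : \forall z \near clamp y, z \in I -> P (f z) by exact: cP.
have : \forall z \near y, clamp z \in I -> P (f (clamp z)).
  exact: clamp_continuous cP'.
by apply: filterS => z; apply; exact: clamp_in.
Qed.

Lemma comp_clamp_bounded {m p} (f : R -> 'M[R]_(m, p)) :
  {within [set` I], continuous f} ->
  exists2 M, 0 <= M & forall y i j, `|f (clamp y) i j| <= M.
Proof.
move=> cf; have cfc := comp_clamp_continuous cf.
have bk (k : 'I_m * 'I_p) : exists M, forall y, `|f (clamp y) k.1 k.2| <= M.
  have [|c _ cP] := @EVT_max R (fun y => `|f (clamp y) k.1 k.2|) _ _ t0T.
    apply: continuous_subspaceT => y; apply: cvg_norm; exact: cfc.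
  exists `|f (clamp c) k.1 k.2| => y.
  have cy := clamp_itv y.
  by have := cP (clamp y); rewrite in_itv/= => /(_ cy); rewrite (clamp_id cy).
have [M M0 fM] := finite_bound bk.
by exists M => // y i j; exact: fM (i, j) y.
Qed.

End clamp.

Section restriction.
Context {R : realType}.
Notation mu := (@lebesgue_measure R).

Lemma mx_RintZ {m p} (k : R) (f : R -> 'M[R]_(m, p)) :
  mx_integrableT f -> mx_Rint (fun x => k *: f x) = k *: mx_Rint f.
Proof.
move=> fi; apply/matrixP => i j; rewrite !mxE -RintegralZl//.
by under eq_Rintegral do rewrite mxE.
Qed.

Lemma mx_integralE {m p} s t (f F : R -> 'M[R]_(m, p)) :
  (forall y, s < y < t -> f y = F y) -> (forall y, ~~ (s < y < t) -> F y = 0) ->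
  mx_integral s t f = mx_Rint F.
Proof.
move=> fF F0; apply/matrixP => i j; rewrite !mxE Rintegral_mkcond.
apply: eq_Rintegral => y _; rewrite patchE mem_setE in_itv/=.
by case: ifPn => [/fF ->//|/F0 ->]; rewrite mxE.
Qed.

Lemma mx_integrableE {m p} s t (f F : R -> 'M[R]_(m, p)) :
  (forall y, s < y < t -> f y = F y) -> mx_integrableT F -> mx_integrable s t f.
Proof.
move=> fF Fi i j.
have : mu.-integrable `]s, t[ (EFin \o (fun x => F x i j)).
  by apply: integrableS (Fi i j).
by apply: eq_integrable => // y /set_mem/=; rewrite in_itv/= => /fF ->.
Qed.

(** Bounded data are dominated by the weight: the weight is at least 1 on
  ]0, 1], and for r >= 1 it is at least l, since the power is at least 1 / r
  and e^(l r) >= l r. *)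
Lemma le1_wpowker (a l r : R) : 0 <= a <= 1 -> 0 < l -> 0 < r ->
  1 <= (1 + l^-1) * wpowker a l r.
Proof.
move=> /andP[a0 a1] l0 r0; have li : 0 < l^-1 by rewrite invr_gt0.
have [r1|r1] := leP r 1.
  have w1 : 1 <= wpowker a l r.
    rewrite /wpowker powker_pos// -[leLHS]mulr1 ler_pM//.
      have e1 : 1 `^ (a - 1) = 1 :> R by rewrite powR1.
      by rewrite -[leLHS]e1 powR_npow_le// subr_le0.
    by rewrite -[leLHS]expR0 ler_expR mulr_ge0 ?(ltW l0) ?(ltW r0).
  by rewrite -[leLHS]mulr1 ler_pM// lerDl ltW.
have w1 : l <= wpowker a l r.
  rewrite /wpowker powker_pos// (@le_trans _ _ (r^-1 * (l * r)))//.
    by rewrite mulrCA mulVf ?mulr1// gt_eqF.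
  rewrite ler_pM ?invr_ge0 ?mulr_ge0 ?(ltW l0) ?(ltW r0)//.
    by rewrite -powR_inv1 ?(ltW r0)// ler_powR ?(ltW r1)//; lra.
  by rewrite (le_trans _ (expR_ge1Dx _))// lerDr.
apply: (@le_trans _ _ (l^-1 * l)); first by rewrite mulVf// gt_eqF.
by rewrite ler_pM ?(ltW li) ?(ltW l0)// lerDr.
Qed.

End restriction.

(** * The solution on [t0, T] *)
Section transfer.
Context {R : realType} {n : nat}.
Notation mu := (@lebesgue_measure R).
Variables (alpha : R) (I : interval R) (t0 T : R) (A : R -> 'M[R]_n).
Variables (u : R -> 'cV[R]_n) (x0 : 'cV[R]_n).
Hypotheses (halpha : 0 < alpha < 1) (It0 : t0 \in I) (IT : T \in I) (t0T : t0 < T).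
Hypothesis hA : {within [set` I], continuous A}.
Hypothesis hu : {within [set` I], continuous u}.

Let a01 : 0 < alpha <= 1. Proof. by case/andP: halpha => -> /ltW. Qed.

Let b01 : 0 < 1 - alpha <= 1.
Proof. by case/andP: halpha => a0 a1; rewrite subr_gt0 a1 gerBl ltW. Qed.

Let Ac y := A (clamp t0 T y).

Let v y : 'cV[R]_n := if t0 < y then u (clamp t0 T y) else 0.

Variables (cA cu l : R).
Hypotheses (cA0 : 0 <= cA) (Ale : mx_bounded_by Ac (fun=> cA)).
Hypotheses (cu0 : 0 <= cu) (ule : forall y i j, `|u (clamp t0 T y) i j| <= cu).
Hypotheses (l0 : 0 < l) (small : n%:R * (cA / Gamma alpha * contraction_rate alpha l)
    <= 2^-1).

Let mAc : mx_measurable Ac.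
Proof.
move=> i j; apply: continuous_measurable_fun.
exact: (comp_clamp_continuous It0 IT (ltW t0T) hA).
Qed.

Let mv : mx_measurable v.
Proof.
move=> i j; rewrite (_ : (fun _ => _) = fun y => if t0 < y then u (clamp t0 T y) i j
    else 0).
  apply: measurable_fun_ifT => //; first exact: measurable_fun_ltr.
  apply: continuous_measurable_fun.
  exact: (comp_clamp_continuous It0 IT (ltW t0T) hu).
by apply/funext => y; rewrite /v; case: ifP => // _; rewrite mxE.
Qed.

Let cv := cu * (1 + l^-1).

Let cv0 : 0 <= cv. Proof. by rewrite mulr_ge0// addr_ge0// invr_ge0 ltW. Qed.

Let vle : mx_bounded_by v (fun y => cv * wpowker alpha l (y - t0)).
Proof.
move=> y i j; rewrite /v; case: ltP => ty; last first.
  by rewrite mxE normr0 mulr_ge0// wpowker_ge0.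
rewrite (le_trans (ule _ _ _))// /cv -[leLHS]mulr1 -mulrA ler_wpM2l//.
by apply: le1_wpowker; rewrite ?subr_gt0// ltW; case/andP: a01.
Qed.

Let AcE y : t0 <= y <= T -> Ac y = A y.
Proof. by move=> yT; rewrite /Ac clamp_id. Qed.

(** Only values of A on ]s, t[ enter the term. *)
Lemma PB_termE k s t : t0 <= s -> s < t -> t <= T ->
  PB_term alpha A s k t = pb_term alpha Ac k t s.
Proof.
elim: k t => [|k IH] t ts st tT; first by rewrite /= powker_pos// subr_gt0.
have G0 := Gamma_gt0 a01.
pose c := (Gamma alpha)^-1 * 2^-1 ^+ k.
have c0 : 0 <= c by rewrite mulr_ge0 ?exprn_ge0 ?invr_ge0 ?(ltW G0).
have ple : mx_bounded_by (fun y => pb_term alpha Ac k y s) (fun y => c * wpowker alpha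
    l (y - s)).
  by move=> y i j; exact: (pb_term_le a01 l0 cA0 mAc Ale small).
pose K y := powker alpha (t - y) *: Ac y.
have Kle y i j : s < y -> `|K y i j| <= cA * powker alpha (t - y).
  move=> _; rewrite mxE normrM ger0_norm ?powker_ge0// mulrC.
  by rewrite ler_wpM2r ?powker_ge0// Ale.
have mK : mx_measurable K.
  move=> i j; rewrite (_ : (fun _ => _) = (fun y => powker alpha (t - y) * Ac y i j));
      last first.
    by apply/funext => y; rewrite mxE.
  apply: measurable_funM; last exact: mAc.
  by apply: (measurableT_comp (measurable_powker alpha)); exact: measurable_funB.
have iK := @mx_integrable_dominated _ alpha l a01 l0 _ _ _ alpha cA c s t K
   (fun y => pb_term alpha Ac k y s) a01 cA0 c0 mK
   (mx_measurable_section2 s (measurable_pb_term alpha mAc k)) Kle ple.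
transitivity ((Gamma alpha)^-1 *: mx_Rint (fun y => K y *m pb_term alpha Ac k y s));
    last first.
  rewrite -mx_RintZ//; apply: eq_mx_Rint => y.
  by rewrite /volterra_kernel /K -!scalemxAl scalerA mulrC.
rewrite /= /RL_int; congr (_ *: _); apply: mx_integralE => y.
  move=> /andP[sy yt]; have tsy := le_lt_trans ts sy.
  rewrite /RL_kernel /K powker_pos ?subr_gt0// -scalemxAl AcE ?(ltW tsy)/=; last first.
    by rewrite (le_trans (ltW yt)).
  by rewrite IH// (le_trans (ltW yt)).
rewrite negb_and -!leNgt => /orP[ys|ty].
  rewrite (_ : pb_term _ _ _ _ _ = 0) ?mulmx0//; apply/matrixP => i j; rewrite mxE.
  have := ple y i j; rewrite wpowker_npos ?subr_le0// mulr0 normr_le0 => /eqP.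
  exact.
by rewrite /K powker_npos ?subr_le0// scale0r mul0mx.
Qed.

Lemma PB_PhiE s t : t0 <= s -> s < t -> t <= T ->
  PB_Phi alpha A t s = pb_resolvent alpha Ac t s.
Proof.
move=> ts st tT; apply: cvg_lim; first exact: norm_hausdorff.
apply: cvg_mx => i j.
have := @pb_resolvent_cvg _ _ _ _ _ _ a01 l0 cA0 mAc Ale small t s i j.
apply: cvg_trans; rewrite (_ : (fun N => _) = series (fun k => pb_term alpha Ac k t s i
    j))//.
apply/funext => N; rewrite /PB_partial summxE.
by apply: eq_bigr => k _; rewrite PB_termE.
Qed.

Let sol t := PB_Phi alpha A t t0 *m x0
  + mx_integral t0 t (fun tau => PB_Phi alpha A t tau *m u tau).

Let gsol := pb_sol alpha Ac t0 x0 v.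

Let rhs := pb_rhs alpha Ac t0 x0 v.

Let PhiE t y : t0 < t <= T -> t0 < y < t ->
  PB_Phi alpha A t y *m u y = pb_resolvent alpha Ac t y *m v y.
Proof.
move=> /andP[tt tT] /andP[ty yt]; rewrite PB_PhiE ?(ltW ty)//.
by rewrite /v ty clamp_id// (ltW ty) (le_trans (ltW yt)).
Qed.

Lemma forcing_integrable t : t0 < t <= T ->
  mx_integrable t0 t (fun tau => PB_Phi alpha A t tau *m u tau).
Proof.
move=> tT; apply: mx_integrableE (fun y => PhiE tT) _.
exact: (pb_conv_integrable a01 l0 cA0 mAc Ale small cv0 mv vle).
Qed.

Lemma sol_pb_sol t : t0 < t <= T -> sol t = gsol t.
Proof.
move=> tT; have /andP[tt tT'] := tT.
rewrite /sol /gsol /pb_sol PB_PhiE//; congr (_ + _).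
apply: mx_integralE => [y|y]; first exact: PhiE.
rewrite negb_and -!leNgt => /orP[ys|ty].
  by rewrite /v ltNge ys/= mulmx0.
rewrite (_ : pb_resolvent _ _ _ _ = 0) ?mul0mx//; apply/matrixP => i j; rewrite [RHS]mxE.
have := pb_resolvent_le a01 l0 cA0 mAc Ale small t y i j.
by rewrite wpowker_npos ?subr_le0// mulr0 normr_le0 => /eqP.
Qed.

Let cX := hom_cst alpha x0 + @conv_cst R n alpha l cv.

Let cX0 : 0 <= cX.
Proof. by rewrite addr_ge0 ?hom_cst_ge0 ?conv_cst_ge0. Qed.

Let l20 : 0 < 2 * l. Proof. by rewrite mulr_gt0. Qed.

Let gsol_le : mx_bounded_by gsol (fun t => cX * wpowker alpha (2 * l) (t - t0)).
Proof. exact: (pb_sol_le a01 l0 cA0 mAc Ale small x0 cv0 mv vle). Qed.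

Let mgsol : mx_measurable gsol.
Proof. exact: (measurable_pb_sol a01 l0 cA0 mAc Ale small t0 x0 mv). Qed.

Let cR := @rhs_cst R n alpha l cA cv x0.

Let rhs_le i y : `|rhs y i 0| <= cR * wpowker alpha (2 * l) (y - t0).
Proof. exact: (pb_rhs_le a01 l0 cA0 mAc Ale small x0 cv0 mv vle). Qed.

Let cR0 : 0 <= cR.
Proof. exact: rhs_cst_ge0. Qed.

Let mrhs i : measurable_fun [set: R] (fun y => rhs y i 0).
Proof. exact: (measurable_pb_rhs a01 l0 cA0 mAc Ale small t0 x0 mv). Qed.

Let gsolE i t : gsol t i 0 = abel_sol alpha t0 (fun y => rhs y i 0) (x0 i 0) t.
Proof. exact: (pb_sol_volterra a01 l0 cA0 mAc Ale small x0 cv0 mv vle). Qed.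

Let RL_kernelE t y : t0 < t <= T -> t0 < y < t ->
  RL_kernel (1 - alpha) sol t y = powker (1 - alpha) (t - y) *: gsol y.
Proof.
move=> /andP[tt tT] /andP[ty yt]; rewrite /RL_kernel powker_pos ?subr_gt0//.
by rewrite sol_pb_sol// ty (le_trans (ltW yt)).
Qed.

Lemma sol_integrable t : t0 < t <= T ->
  mx_integrable t0 t (RL_kernel (1 - alpha) sol t).
Proof.
move=> tT; apply: mx_integrableE (fun y => RL_kernelE tT) _ => i j.
have : mu.-integrable [set: R] (EFin \o (fun y => powker (1 - alpha) (t - y) * gsol y i
    j)).
  apply: (@integrable_dominated _ alpha (2 * l) a01 l20 (1 - alpha) 1 cX t0 t) => //.
  - by apply: (measurableT_comp (measurable_powker _)); exact: measurable_funB.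
  - by move=> y _; rewrite ger0_norm ?powker_ge0// mul1r.
by apply: eq_integrable => // y _; congr EFin; rewrite [RHS]mxE.
Qed.

Let G i t := primitive (fun y => rhs y i 0) t.

Lemma sol_RL t i : t0 < t <= T ->
  RL_int (1 - alpha) t0 sol t i 0 = x0 i 0 + G i t.
Proof.
move=> tT; have /andP[tt tT'] := tT; rewrite /RL_int.
rewrite (@mx_integralE _ _ _ _ _ _ (fun y => powker (1 - alpha) (t - y) *: gsol y)).
- rewrite !mxE; under eq_Rintegral do rewrite mxE gsolE.
  rewrite (abel_sol_RL halpha l20 cR0 (mrhs i) (rhs_le i))//.
  by rewrite mulKf// gt_eqF// Gamma_gt0.
- by move=> y; exact: RL_kernelE.
- move=> y; rewrite negb_and -!leNgt => /orP[ys|ty].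
    rewrite (_ : gsol y = 0) ?scaler0//; apply/matrixP => i' j; rewrite [RHS]mxE.
    have := gsol_le y i' j.
    by rewrite wpowker_npos ?subr_le0// mulr0 normr_le0 => /eqP.
  by rewrite powker_npos ?subr_le0// scale0r.
Qed.

Lemma primitive_rhs_cvg0 i : G i t @[t --> t0^'+] --> 0.
Proof. exact: (primitive_cvg0 halpha l20 cR0 (mrhs i) (rhs_le i)). Qed.

Lemma gsol_continuous t i : t0 < t -> {for t, continuous (fun t => gsol t i 0)}.
Proof.
move=> tt; have e : (fun r => gsol r i 0) = abel_sol alpha t0 (fun y => rhs y i 0) (x0
    i 0).
  by apply/funext => r; rewrite gsolE.
rewrite e.
apply: cvgMr; apply: cvgD.
  apply: cvgMl.
  have cp : {for t, continuous (fun r => (r - t0) `^ (alpha - 1))}.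
    apply: (continuous_comp (f := fun r => r - t0) (g := fun r => r `^ (alpha - 1))).
      by apply: cvgB => //; exact: cvg_cst.
    apply/differentiable_continuous/derivable1_diffP.
    by apply: derivable_powR; rewrite in_itv/= subr_gt0 tt.
  rewrite [X in _ --> X]powker_pos ?subr_gt0//.
  apply: cvg_trans cp; apply: near_eq_cvg; near=> r.
  by rewrite powker_pos// subr_gt0; near: r; exact: lt_nbhsr.
exact: (abel_int_continuous halpha l20 cR0 (mrhs i) (rhs_le i)).
Unshelve. all: by end_near. Qed.

Lemma rhs_continuous t i : t0 < t -> {for t, continuous (fun t => rhs t i 0)}.
Proof.
move=> tt.
rewrite (_ : (fun t => _) = fun t => v t i 0 + \sum_k Ac t i k * gsol t k 0); last first.
  by apply/funext => y; rewrite /rhs /pb_rhs !mxE.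
apply: cvgD.
  rewrite [X in _ --> X](_ : _ = u (clamp t0 T t) i 0); last by rewrite /v tt.
  have cu' : {for t, continuous (fun y => u (clamp t0 T y) i 0)}.
    exact: (comp_clamp_continuous It0 IT (ltW t0T) hu).
  apply: cvg_trans cu'; apply: near_eq_cvg; near=> r.
  have tr : t0 < r by near: r; exact: lt_nbhsr.
  by rewrite /v tr.
apply: cvg_sum_seq => k; apply: cvgM; last exact: gsol_continuous.
exact: (comp_clamp_continuous It0 IT (ltW t0T) hA).
Unshelve. all: by end_near. Qed.

Lemma rhsE t : t0 < t <= T -> rhs t = A t *m sol t + u t.
Proof.
move=> tT; have /andP[tt tT'] := tT.
have tc : t0 <= t <= T by rewrite (ltW tt).
by rewrite /rhs /pb_rhs /v tt AcE// clamp_id// -/gsol sol_pb_sol// addrC.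
Qed.

Lemma primitive_rhs_derivative t i : t0 < t <= T ->
  (r - t)^-1 * (G i r - G i t) @[r --> t^'] --> (A t *m sol t + u t) i 0.
Proof.
move=> tT; have /andP[tt _] := tT; rewrite -rhsE//.
have rc := @rhs_continuous t i tt.
have := primitive_derivative halpha l20 cR0 (mrhs i) (rhs_le i) tt rc.
by [].
Qed.

End transfer.

(** * The initial value problem *)
Section main.
Context {R : realType} {n : nat}.
Variables (alpha : R) (I : interval R) (t0 : R) (A : R -> 'M[R]_n).
Variables (u : R -> 'cV[R]_n) (x0 : 'cV[R]_n).
Hypotheses (halpha : 0 < alpha < 1) (ht0 : t0 \in I).
Hypothesis hA : {within [set` I], continuous A}.
Hypothesis hu : {within [set` I], continuous u}.

Let x := (fun t => PB_Phi alpha A t t0 *m x0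
              + mx_integral t0 t (fun tau => PB_Phi alpha A t tau *m u tau)).

(** G is the primitive of the entries of A x + u built from the coefficients
  projected onto [t0, T], so that it is defined on the whole line and has a
  two-sided derivative even at T. It depends on T; x does not. *)
Lemma solution_up_to T : T \in I -> t0 < T -> exists G : R -> 'cV[R]_n,
  [/\ forall t, t0 < t <= T ->
        mx_integrable t0 t (fun tau => PB_Phi alpha A t tau *m u tau) /\
        mx_integrable t0 t (RL_kernel (1 - alpha) x t),
      forall t, t0 < t <= T -> RL_int (1 - alpha) t0 x t = x0 + G t,
      G t @[t --> t0^'+] --> (0 : 'cV[R]_n) &
      forall t, t0 < t <= T ->
        (r - t)^-1 *: (G r - G t) @[r --> t^'] --> A t *m x t + u t].
Proof.
move=> IT t0T.
have [cA cA0 Ale] := comp_clamp_bounded ht0 IT (ltW t0T) hA.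
have [cu cu0 ule] := comp_clamp_bounded ht0 IT (ltW t0T) hu.
have a01 : 0 < alpha <= 1 by case/andP: halpha => -> /ltW.
have G0 := Gamma_gt0 a01.
pose M := n%:R * (cA / Gamma alpha).
have M0 : 0 <= M by rewrite !mulr_ge0// invr_ge0 ltW.
have e0 : 0 < (2 * (M + 1))^-1 by rewrite invr_gt0 mulr_gt0// ltr_pwDr.
have [l l0 small] := contraction_rate_small a01 e0.
have small' : n%:R * (cA / Gamma alpha * contraction_rate alpha l) <= 2^-1.
  rewrite mulrA -/M (le_trans (ler_wpM2l M0 small))//.
  by rewrite invfM mulrCA ler_piMr ?invr_ge0// ler_pdivrMr ?mul1r ?lerDl// ltr_pwDr.
exists (fun t => \col_i primitive (fun y => pb_rhs alpha (fun y => A (clamp t0 T y)) t0 x0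
  (fun y => if t0 < y then u (clamp t0 T y) else 0) y i 0) t).
split.
- move=> t tT; split.
    exact: (forcing_integrable halpha ht0 IT t0T hA hu cA0 Ale cu0 ule l0 small' tT).
  exact: (sol_integrable x0 halpha ht0 IT t0T hA hu cA0 Ale cu0 ule l0 small' tT).
- move=> t tT; apply/matrixP => i j; rewrite (ord1 j) [RHS]mxE.
  rewrite (sol_RL x0 halpha ht0 IT t0T hA hu cA0 Ale cu0 ule l0 small' i tT).
  by congr (_ + _); rewrite mxE.
- apply: cvg_mx => i j; rewrite [X in _ --> X]mxE; under eq_fun do rewrite mxE.
  exact: (@primitive_rhs_cvg0 _ _ _ _ _ _ _ _ x0 halpha ht0 IT t0T hA hu _ _ _ cA0 Ale
      cu0 ule l0 small').
- move=> t tT; apply: cvg_mx => i j; rewrite (ord1 j).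
  under eq_fun do rewrite !mxE.
  exact: (@primitive_rhs_derivative _ _ _ _ _ _ _ _ x0 halpha ht0 IT t0T hA hu _ _ _
      cA0 Ale cu0 ule l0 small' _ i tT).
Qed.

End main.

Theorem theorem3 (R : realType) (n : nat) (alpha : R) (I : interval R) (t0 : R)
    (A : R -> 'M[R]_n) (u : R -> 'cV[R]_n) (x0 : 'cV[R]_n)
    (halpha : 0 < alpha < 1) (ht0 : t0 \in I)
    (hA : {within [set` I], continuous A})
    (hu : {within [set` I], continuous u})
    (hPB : PB_converges_uniformly I alpha A) :
  (forall t, t \in I -> t0 < t ->
     mx_integrable t0 t (fun tau => PB_Phi alpha A t tau *m u tau)) /\
  is_RL_IVP_solution I alpha t0 A u x0
    (fun t => PB_Phi alpha A t t0 *m x0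
              + mx_integral t0 t (fun tau => PB_Phi alpha A t tau *m u tau)).
Proof.
set x := (fun t => _ + _).
have key T (IT : T \in I) := solution_up_to x0 halpha ht0 hA hu IT.
split.
  move=> t It tt; have [G [H _ _ _]] := key t It tt.
  by have [] := H t; rewrite ?tt ?lexx.
split.
- move=> t It tt; have [G [H _ _ _]] := key t It tt.
  by have [] := H t; rewrite ?tt ?lexx.
- move=> t It tt; rewrite /is_RL_derivative /is_derivative_in.
  (* a time beyond t if there is one in I, and t itself if t is the right end of I *)
  have [T [IT tT Tnear]] : exists T, [/\ T \in I, t <= T &
      \forall r \near t, r \in I -> r <= T].
    have [[T [IT tT]]|noT] := pselect (exists T, T \in I /\ t < T).
      by exists T; split => //; [exact: ltW|near=> r => _; near: r; exact: lt_le_nbhsl].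
    exists t; split => //; near=> r => Ir; rewrite leNgt; apply/negP => tr.
    by apply: noT; exists r.
  have t0T := lt_le_trans tt tT.
  have [G [_ RLE _ dG]] := key T IT t0T.
  have ttT : t0 < t <= T by rewrite tt.
  have := dG t ttT => {dG} dG.
  apply: (@cvg_trans _ ((r - t)^-1 *: (G r - G t) @[r --> within [set` I] t^'])); last
      first.
    by apply: cvg_trans dG; apply: cvg_app; exact: cvg_within.
  apply: near_eq_cvg; rewrite near_withinE; apply: cvg_within.
  near=> r => Ir; rewrite !RLE//.
    by congr (_ *: _); rewrite opprD addrACA subrr add0r.
  apply/andP; split; first by near: r; exact: lt_nbhsr.
  by move: Ir; near: r.
- have [[T [IT t0T]]|noT] := pselect (exists T, T \in I /\ t0 < T).
    have [G [_ RLE G0 _]] := key T IT t0T.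
    have xG : x0 + G r @[r --> t0^'+] --> x0.
      suff : x0 + G r @[r --> t0^'+] --> x0 + 0 by rewrite addr0.
      by apply: cvgD => //; exact: cvg_cst.
    apply: (@cvg_trans _ (x0 + G r @[r --> within [set` I] t0^'+])); last first.
      by apply: cvg_trans xG; apply: cvg_app; exact: cvg_within.
    apply: near_eq_cvg; near=> r.
    rewrite RLE//; apply/andP; split.
      by near: r; apply: cvg_within; exact: nbhs_right_gt.
    by near: r; apply: cvg_within; exact: nbhs_right_le.
  move=> P _; rewrite /nbhs/= /within/=.
  apply: filterS (nbhs_right_gt t0) => r tr Ir.
  by exfalso; apply: noT; exists r.
Unshelve. all: by end_near.
Qed.
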